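(* Let $\mathcal{X}=\mathcal{X}_1\times\cdots\times\mathcal{X}_d$, $\sigma>0$, and $\mathcal{Q}:\mathcal{X}\to\mathbb{R}^m$. Define $\Delta=\sup\{\|\mathcal{Q}(u)-\mathcal{Q}(v)\|_2: u,v\in\mathcal{X}\}$ and $\Delta_0=\sup\{\|\mathcal{Q}(u)-\mathcal{Q}(v)\|_2:u,v\in\mathcal{X},\|u-v\|_0\le1\}$. Define $M:\mathcal{X}^n\to\mathbb{R}^m$ as follows: on input $x\in\mathcal{X}^n$, compute $\mathcal{Q}(x)=\frac1n\sum_{i=1}^n\mathcal{Q}(x_i)$, sample $Y\sim\mathcal{N}(\mathcal{Q}(x),\sigma^2I)$, and output $\hat Y=\arg\min_{y\in \mathrm{conv}(\{\mathcal{Q}(u):u\in\mathcal{X}\})}\|y-Y\|_2$. Then $M$ simultaneously satisfies $\frac12\varepsilon^2$-zCDP and $\varepsilon_0$-$\nabla_0$CDP with $\varepsilon=\frac{\Delta}{\sigma n}$ and $\varepsilon_0=\frac{\Delta_0}{\sigma n}$. Furthermore, for all $x\in\mathcal{X}^n$, $$\mathbb{E}\left[\frac1m\|M(x)-\mathcal{Q}(x)\|_2^2\right]\le\min\left\{\sigma^2,\ \frac{\sigma\cdot\Delta\cdot\sqrt{2\log|\mathcal{X}|}}{m}\right\}$$ (where the second term is read as $+\infty$ if $\mathcal{X}$ is infinite).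
   Context: $\mathrm{conv}$ denotes convex hull; $\|u-v\|_0=|\{j\in[d]:u_j\ne v_j\}|$. Rényi divergence $D_\lambda(P\|Q)=\frac{1}{\lambda-1}\log\mathbb{E}_{X\sim P}[(P(X)/Q(X))^{\lambda-1}]$ and $D_*(P\|Q)=\sup_{\lambda>1}\frac1\lambda D_\lambda(P\|Q)$. $M$ is $\frac12\varepsilon^2$-zCDP if $D_*(M(x)\|M(x'))\le\frac12\varepsilon^2$ for all $x,x'\in\mathcal{X}^n$ differing in a single entry. $M$ is $\varepsilon_0$-$\nabla_0$CDP if for all $x,x'\in\mathcal{X}^n$ differing only in entry $i$, $D_*(M(x)\|M(x'))\le\frac12\varepsilon_0^2\|x_i-x'_i\|_0^2$.
   Formalization: The argmin is taken over the closure of conv({Q(u)}), since for infinite X the hull need not be closed and the argmin may not exist (e.g. X=(0,1), Q the identity); the two agree whenever the argmin over the hull exists. Also n ≥ 1 is assumed. *)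

(* Defs.v *)
From HB Require Import structures.
From mathcomp Require Import all_boot all_order all_algebra.
From mathcomp Require Import all_classical all_reals all_analysis.
Set Implicit Arguments. Unset Strict Implicit. Unset Printing Implicit Defensive.
Import Order.TTheory GRing.Theory Num.Theory.
Import numFieldNormedType.Exports.
Local Open Scope classical_set_scope.
Local Open Scope ring_scope.

(* ---------- vectors of R^m, represented as m.-tuple R (measurable via the
   product sigma-algebra of the coordinates = Borel sigma-algebra of R^m) *)
Section vec.
Context {R : realType} {m : nat}.

Definition vadd (u v : m.-tuple R) : m.-tuple R := [tuple tnth u j + tnth v j | j < m].
Definition vsub (u v : m.-tuple R) : m.-tuple R := [tuple tnth u j - tnth v j | j < m].
Definition vnorm (u : m.-tuple R) : R := Num.sqrt (\sum_(j < m) tnth u j ^+ 2).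

Definition conv (S : set (m.-tuple R)) : set (m.-tuple R) :=
  [set y | exists (k : nat) (w : 'I_k -> R) (p : 'I_k -> m.-tuple R),
     [/\ (forall i, 0 <= w i), \sum_(i < k) w i = 1, (forall i, S (p i)) &
         y = [tuple \sum_(i < k) w i * tnth (p i) j | j < m]]].

Definition vclosure (C : set (m.-tuple R)) : set (m.-tuple R) :=
  [set p | forall e : R, 0 < e -> exists2 z, C z & vnorm (vsub p z) < e].

(* Euclidean projection of y onto the (closed) convex hull of S:
   the point of the closure of conv S minimizing the distance to y,
   i.e. argmin_{p in conv S} ||p - y||_2 (taken in the closure so that it
   always exists; it is unique). *)
Definition hull_proj (S : set (m.-tuple R)) (y : m.-tuple R) : m.-tuple R :=
  xget y [set p | vclosure (conv S) p /\
                  forall z, conv S z -> vnorm (vsub p y) <= vnorm (vsub z y)].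
End vec.

Definition ham0 (d : nat) (T : 'I_d -> Type) (u v : forall j : 'I_d, T j) : nat :=
  #|[set j : 'I_d | `[< u j <> v j >]]|.

Definition differ_only_at (XT : Type) (n : nat) (i : 'I_n) (x x' : 'I_n -> XT) :=
  forall j : 'I_n, j != i -> x j = x' j.

Section renyi.
Context {d : measure_display} {T : measurableType d} {R : realType}.
Local Open Scope ereal_scope.

Definition density_of (P Q : set T -> \bar R) (f : T -> R) : Prop :=
  [/\ measurable_fun setT f, (forall t, (0 <= f t)%R) &
      forall A, measurable A -> P A = \int[Q]_(t in A) (f t)%:E].

Definition renyi (lam : R) (P Q : set T -> \bar R) : \bar R :=
  match pselect (exists f, density_of P Q f) with
  | left h => let f := proj1_sig (cid h) in
      ((lam - 1)^-1)%:E * lne (\int[P]_t ((f t) `^ (lam - 1))%:E)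
  | right _ => +oo
  end.

Definition renyi_star (P Q : set T -> \bar R) : \bar R :=
  ereal_sup [set r | exists2 lam : R, (1 < lam)%R & r = (lam^-1)%:E * renyi lam P Q].
End renyi.

Section mech.
Context {R : realType} {m n : nat} {XT : Type}.

Definition qavg (Q : XT -> m.-tuple R) (x : 'I_n -> XT) : m.-tuple R :=
  [tuple (n%:R^-1 * \sum_(i < n) tnth (Q (x i)) j) | j < m].

(* M(x) = projection onto conv(Q(X)) of Y = Q(x) + sigma * Z, where Z is a
   standard Gaussian vector (so Y ~ N(Q(x), sigma^2 I)) *)
Definition gauss_mech {dO : measure_display} {Omega : measurableType dO}
  (Q : XT -> m.-tuple R) (sigma : R) (Z : 'I_m -> Omega -> R)
  (x : 'I_n -> XT) (w : Omega) : m.-tuple R :=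
  hull_proj (range Q) (vadd (qavg Q x) [tuple sigma * Z j w | j < m]).
End mech.

Definition iid_std_normal {R : realType} {dO : measure_display}
  {Omega : measurableType dO} (P : probability Omega R) (m : nat)
  (Z : 'I_m -> Omega -> R) : Prop :=
  (forall j, measurable_fun setT (Z j)) /\
  forall A : 'I_m -> set R, (forall j, measurable (A j)) ->
    P (\bigcap_(j in [set: 'I_m]) (Z j @^-1` A j)) =
    (\prod_(j < m) normal_prob 0 1 (A j))%E.

(* Delta = sup ||Q(u)-Q(v)||_2 and Delta_0 (restricted to ||u-v||_0 <= 1) *)
Definition sens {R : realType} {m : nat} (XT : Type) (Q : XT -> m.-tuple R)
  (adm : XT -> XT -> Prop) : \bar R :=
  ereal_sup [set r | exists u v, adm u v /\ r = (vnorm (vsub (Q u) (Q v)))%:E].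

Definition card_bound {R : realType} (XT : Type) (sigma : R) (Delta : \bar R)
  (m : nat) : \bar R :=
  match pselect (finite_set [set: XT]) with
  | left h => let N := proj1_sig (cid h) in
      ((sigma * Num.sqrt (2 * ln (N%:R : R)) / m%:R)%:E * Delta)%E
  | right _ => +oo%E
  end.

(* Main.v *)
(* Privacy. Replacing one entry of the input shifts the mean of the Gaussian
   vector by v = (Q(x_i) - Q(x'_i)) / n, so M(x) and M(x') are one and the same
   map (translation, scaling, projection) applied to Z + v / sigma and to Z.  The law
   of Z + c has density L = exp(<c, Z> - |c|^2 / 2) with respect to that of Z,
   E[L^lambda] = exp(lambda (lambda - 1) |c|^2 / 2), and the data processing
   inequality gives D_* <= |c|^2 / 2.  For the second claim, change x_i into x'_i
   one coordinate at a time and use the triangle inequality.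

   Accuracy. With p the projection of Y = q + sigma Z and q in the hull,
   |p - q|^2 <= <Y - q, p - q> = sigma <Z, p - q>.  This yields |p - q| <= sigma |Z|,
   and also |p - q|^2 <= sigma max_u <Z, Q(u) - q>, a maximum of |X| centred
   Gaussian variables of standard deviation at most Delta. *)

Require Import Defs.
From HB Require Import structures.
From mathcomp Require Import all_boot all_order all_algebra.
From mathcomp Require Import all_classical all_reals all_analysis.
From mathcomp Require Import measurable_realfun ring lra.
Import Order.TTheory GRing.Theory Num.Theory.
Import numFieldNormedType.Exports.
Local Open Scope classical_set_scope.
Local Open Scope ring_scope.

(** The divergence needs a density of one output law with respect to the other, and since projecting
    can put mass on the boundary of the hull, neither law need have a Lebesgue density. The density
    is therefore supplied by Radon-Nikodym, no formula for it is at hand, and the moment bound has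
    to hold for whichever density is chosen; this shapes the data processing part. Independence is
    available only as a product formula on boxes. The density formula for Z + c is proved there,
    coordinate by coordinate, and extended by uniqueness of measures. All exponential moments, and
    from them the bound E[Z_j^2] <= 1 behind the error sigma^2, follow from the fact that the tilted
    measure has mass one. Measurability of M is an obligation of its own, met by showing that the
    projection is 1-Lipschitz. In the second privacy claim the triangle inequality is applied to
    distances between values of Q before squaring, not to divergences; this gives the square of the
    Hamming distance. The sensitivities may be infinite, so these steps are carried out in the
    extended reals. *)

(** * Change of variables and of density for nonnegative integrals *)

Section transfer.
Import HBNNSimple.
Local Open Scope ereal_scope.
Context {d1 d2 : measure_display} {X : measurableType d1} {Y : measurableType d2}
  {R : realType}.

(** One formula for image measures and for densities: [G = 1] is the change of variables, [phi = id]
    the change of density. The hypothesis on [nu] is the claim for indicators; simple approximations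
    and monotone convergence do the rest. *)
Lemma ge0_integral_transfer (mu : {measure set X -> \bar R})
    (nu : {measure set Y -> \bar R}) (phi : X -> Y) (G : X -> R) (F : Y -> \bar R) :
  measurable_fun setT phi -> measurable_fun setT G -> (forall x, (0 <= G x)%R) ->
  (forall A, measurable A -> nu A = \int[mu]_(x in phi @^-1` A) (G x)%:E) ->
  measurable_fun setT F -> (forall y, 0 <= F y) ->
  \int[nu]_y F y = \int[mu]_x (F (phi x) * (G x)%:E).
Proof.
move=> mphi mG G0 nuE mF F0.
pose h := nnsfun_approx measurableT mF.
have mG' : measurable_fun setT (fun x => (G x)%:E) by exact/measurable_EFinP.
have hcvg y : (h n y)%:E @[n --> \oo] --> F y by exact: cvg_nnsfun_approx.
have hnd y a b : (a <= b)%N -> (h a y <= h b y)%R.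
  by move=> ab; exact/lefP/nd_nnsfun_approx.
have -> : \int[nu]_y F y = limn (fun n => \int[nu]_y (h n y)%:E).
  rewrite -monotone_convergence//.
  - by apply: eq_integral => y _; apply/esym/cvg_lim => //.
  - by move=> n; exact/measurable_EFinP.
  - by move=> n y _; rewrite lee_fin.
  - by move=> y _ a b ab; rewrite lee_fin hnd.
have -> : \int[mu]_x (F (phi x) * (G x)%:E) =
    limn (fun n => \int[mu]_x ((h n (phi x))%:E * (G x)%:E)).
  rewrite -monotone_convergence//.
  - apply: eq_integral => x _; apply/esym/cvg_lim => //.
    by apply: cvgeZr.
  - move=> n; apply: emeasurable_funM => //.
    by apply/measurable_EFinP; exact: measurableT_comp.
  - by move=> n x _; rewrite mule_ge0// lee_fin.
  - by move=> x _ a b ab; rewrite lee_wpmul2r ?lee_fin ?hnd.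
congr (limn _); apply/funext => n.
have mind r : measurable_fun setT (fun x => (r * \1_(h n @^-1` [set r]) (phi x))%:E).
  apply/measurable_EFinP; apply: measurable_funM => //.
  by apply: (measurableT_comp _ mphi); exact: measurable_indic.
transitivity (\int[nu]_y
    (\sum_(r \in range (h n)) (r * \1_(h n @^-1` [set r]) y)%:E)).
  by apply: eq_integral => y _; rewrite fimfunE -fsumEFin.
rewrite ge0_integral_fsum//; last 2 first.
- by move=> r; apply/measurable_EFinP; exact: measurable_funM.
- by move=> r y _; exact: nnfun_muleindic_ge0.
transitivity (\int[mu]_x
    (\sum_(r \in range (h n)) (r * \1_(h n @^-1` [set r]) (phi x))%:E * (G x)%:E)).
  rewrite ge0_integral_fsum//; last 2 first.
  - by move=> r; exact: emeasurable_funM.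
  - by move=> r x _; rewrite mule_ge0 ?lee_fin//; exact: nnfun_muleindic_ge0.
  apply: eq_fsbigr => r /[!inE] rhn.
  have r0 : (0 <= r)%R by case: rhn => y _ <-.
  under [RHS]eq_integral do rewrite EFinM -muleA.
  have mpre : measurable (h n @^-1` [set r]) by [].
  have mphir : measurable (phi @^-1` (h n @^-1` [set r])).
    by rewrite -[X in measurable X]setTI; exact: mphi.
  rewrite integralZl_indic_nnsfun// ge0_integralZl//; last 2 first.
  - apply: emeasurable_funM => //; apply/measurable_EFinP.
    by apply: (measurableT_comp _ mphi); exact: measurable_indic.
  - by move=> x _; rewrite mule_ge0// lee_fin.
  congr (_ * _); rewrite integral_indic// setIT nuE// integral_mkcond.
  apply: eq_integral => x _; rewrite patchE indicE.
  by rewrite [x \in _](_ : _ = (phi x \in h n @^-1` [set r])) //; case: ifP; rewrite ?mul1e ?mul0e.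
apply: eq_integral => x _; rewrite -ge0_mule_fsuml.
  by rewrite fsumEFin// -fimfunE.
by move=> r; exact: nnfun_muleindic_ge0.
Qed.

Lemma density_measure_exists (mu : {measure set X -> \bar R}) (G : X -> R) :
  measurable_fun setT G -> (forall x, (0 <= G x)%R) ->
  exists nu : {measure set X -> \bar R},
    forall A, measurable A -> nu A = \int[mu]_(x in A) (G x)%:E.
Proof.
move=> mG G0; pose nu A := \int[mu]_(x in A) (G x)%:E.
have nu0 : nu set0 = 0 by exact: integral_set0.
have nu_ge0 A : 0 <= nu A by apply: integral_ge0 => x _; rewrite lee_fin.
have nuS : semi_sigma_additive nu.
  move=> F mF tF mUF; rewrite /nu ge0_integral_bigcup//=.
  - by apply: is_cvg_ereal_nneg_natsum_cond => n _ _; exact: nu_ge0.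
  - by apply/measurable_EFinP; exact: measurable_funTS.
  - by move=> x _; rewrite lee_fin.
pose m := isMeasure.Build _ _ _ nu nu0 nu_ge0 nuS.
pose nuM : {measure set X -> \bar R} := HB.pack nu m.
by exists nuM.
Qed.

End transfer.

(** * Translation of the one-dimensional standard normal law *)

Section normal_shift.
Local Open Scope ereal_scope.
Context {R : realType}.
Local Notation mu := (@lebesgue_measure R).
Implicit Types (c : R) (A : set R).

Lemma lebesgue_measure_shift c A : measurable A ->
  pushforward mu (+%R^~ c : _ -> measurableTypeR R) A = mu A.
Proof.
move=> mA; apply/esym/lebesgue_measure_unique => //=.
  exact: measurable_funD.
move=> _ _ [[a b]] _ <-.
rewrite /pushforward /=.
rewrite [X in _ = mu X](_ : _ = `](a - c)%R, (b - c)%R]%classic); last first.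
  by apply/seteqP; split=> x /=; rewrite !in_itv/= ltrBlDr lerBrDr.
rewrite !lebesgue_measure_itv/= !lte_fin ltrD2r.
by case: ifP => // _; rewrite -!EFinB; congr _%:E; ring.
Qed.

Lemma ge0_integral_normal (F : R -> \bar R) :
  measurable_fun setT F -> (forall y, 0 <= F y) ->
  \int[normal_prob 0 1]_y F y = \int[mu]_x (F x * (normal_pdf 0 1 x)%:E).
Proof.
move=> mF F0; apply: (@ge0_integral_transfer _ _ _ _ _ _ _ id) => //.
- exact: measurable_normal_pdf.
- exact: normal_pdf_ge0.
Qed.

Lemma normal_pdf_shift c (x : R) :
  normal_pdf 0 1 (x - c)%R = (expR (c * x - c ^+ 2 / 2) * normal_pdf 0 1 x)%R.
Proof.
rewrite !normal_pdfE ?oner_neq0// [RHS]mulrCA; congr (_ * _)%R.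
by rewrite /normal_fun -expRD; congr expR; rewrite expr1n; field.
Qed.

(** The exponential is the likelihood ratio of N(c, 1) to N(0, 1), obtained by completing the square
    in [normal_pdf_shift]; translation invariance of Lebesgue measure moves the shift from the set
    to the density. *)
Lemma normal_prob_shift c A : measurable A ->
  normal_prob 0 1 ((+%R^~ c) @^-1` A) =
  \int[normal_prob 0 1]_x ((\1_A x)%:E * (expR (c * x - c ^+ 2 / 2))%:E).
Proof.
move=> mA.
have mexp : measurable_fun setT (fun x : R => expR (c * x - c ^+ 2 / 2)).
  apply: measurableT_comp => //; apply: measurable_funB => //.
have mind : measurable_fun setT (fun x : R => (\1_A x)%:E : \bar R).
  by apply/measurable_EFinP; exact: measurable_indic.
have mshift : measurable_fun setT (+%R^~ c : R -> measurableTypeR R).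
  exact: measurable_funD.
rewrite ge0_integral_normal; last 2 first.
- by apply: emeasurable_funM => //; apply/measurable_EFinP.
- by move=> x; rewrite mule_ge0// lee_fin ?expR_ge0.
pose H (y : R) := (\1_A y)%:E * (normal_pdf 0 1 (y - c))%:E.
have mH : measurable_fun setT H.
  apply: emeasurable_funM => //; apply/measurable_EFinP.
  by apply: measurableT_comp; [exact: measurable_normal_pdf|exact: measurable_funB].
have H0 y : 0 <= H y by rewrite mule_ge0// lee_fin ?normal_pdf_ge0.
transitivity (\int[mu]_y H y); last first.
  by apply: eq_integral => y _; rewrite /H normal_pdf_shift EFinM muleA.
transitivity (\int[pushforward mu (+%R^~ c : R -> measurableTypeR R)]_y H y).
  rewrite ge0_integral_pushforward//= preimage_setT /normal_prob integral_mkcond.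
  apply: eq_integral => x _; rewrite /= patchE /H addrK indicE.
  rewrite [x \in _](_ : _ = ((x + c)%R \in A))//.
  by case: ifP; rewrite ?mul1e ?mul0e.
by apply: eq_measure_integral => A' mA' _; exact: lebesgue_measure_shift.
Qed.

End normal_shift.

(** * Products over independent coordinates, and the generating boxes *)

Section gaussian_vector.
Local Open Scope ereal_scope.
Context {R : realType} {dO : measure_display} {Omega : measurableType dO}
  (P : probability Omega R) {m : nat} (Z : 'I_m -> Omega -> R).
Hypothesis Ziid : iid_std_normal P Z.
Local Notation N01 := (@normal_prob R 0 1).

Let mZ j : measurable_fun setT (Z j). Proof. by case: Ziid. Qed.

Lemma measurable_prod_coord (F : 'I_m -> R -> R) (p : pred 'I_m) :
  (forall j, measurable_fun setT (F j)) ->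
  measurable_fun setT (fun w => (\prod_(j < m | p j) F j (Z j w))%R).
Proof.
move=> mF; under eq_fun do rewrite big_mkcond.
apply: measurable_prod => j _; case: (p j) => //.
exact: measurableT_comp.
Qed.

(* The indicators among the [F j] are replaced by general functions one
   coordinate at a time. *)
Lemma integral_prod_coord (F : 'I_m -> R -> R) (c : 'I_m -> R) :
  (forall j, measurable_fun setT (F j)) -> (forall j x, 0 <= F j x)%R ->
  (forall j, \int[N01]_x (F j x)%:E = (c j)%:E) ->
  \int[P]_w (\prod_(j < m) F j (Z j w))%:E = (\prod_(j < m) c j)%:E.
Proof.
(* [k] counts the coordinates allowed to carry a general function; those of index at least [k] still
   carry an indicator. The base case is the product formula of [iid_std_normal], and [k = m] is the
   claim. *)
suff H k : forall (F : 'I_m -> R -> R) (c : 'I_m -> R), (forall j, measurable_fun setT (F j)) ->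
    (forall j x, 0 <= F j x)%R ->
    (forall j, \int[N01]_x (F j x)%:E = (c j)%:E) ->
    (forall j : 'I_m, (k <= j)%N -> exists2 A, measurable A & F j = \1_A) ->
    \int[P]_w (\prod_(j < m) F j (Z j w))%:E = (\prod_(j < m) c j)%:E.
  move=> mF F0 Fc; apply: (H m) => // j.
  by rewrite leqNgt ltn_ord.
elim: k => [|k IH] {}F {}c mF F0 Fc Find.
  have /choice[A /all_and2[mA FA]] : forall j, exists A, measurable A /\ F j = \1_A.
    by move=> j; have [A mA FjA] := Find j (leq0n _); exists A.
  transitivity (\int[P]_w (\1_(\bigcap_(j in [set: 'I_m]) (Z j @^-1` A j)) w)%:E).
    apply: eq_integral => w _; congr _%:E; rewrite indicE.
    have [/set_mem wA|/negP wA] := boolP (w \in _).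
      rewrite big1 // => j _; rewrite FA indicE mem_set//.
      exact: wA.
    have [j wj] : exists j, ~ A j (Z j w).
      by apply/existsNP => h; apply: wA; apply/mem_set => j _; exact: h.
    by rewrite (bigD1 j)//= FA indicE memNset// mul0r.
  rewrite integral_indic//; last first.
    apply: fin_bigcap_measurable => // j _.
    by rewrite -[X in measurable X]setTI; exact: mZ.
  rewrite setIT; have [_ PA] := Ziid; apply: (eq_trans (PA A mA)); rewrite -prodEFin.
  apply: eq_bigr => j _; rewrite -Fc FA integral_indic //.
    by apply: (congr1 N01); rewrite setIT.
  exact: mA.
have [mk|km] := leqP m k.
  by apply: IH => // j kj; have := leq_trans mk kj; rewrite leqNgt ltn_ord.
pose j0 := Ordinal km.
pose G w := (\prod_(j < m | j != j0) F j (Z j w))%R.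
have c0 j : (0 <= c j)%R.
  by rewrite -lee_fin -Fc; apply: integral_ge0 => x _; rewrite lee_fin.
have K0 : (0 <= \prod_(j < m | j != j0) c j)%R by apply: prodr_ge0.
have mG : measurable_fun setT G by exact: measurable_prod_coord.
have G0 w : (0 <= G w)%R by apply: prodr_ge0.
(* By the induction hypothesis with an indicator put at [j0], the measure of density [G] has a
   multiple of [N01] as its image under [Z j0]. The transfer lemma then admits a general [F j0]. *)
have key A : measurable A ->
    \int[P]_(w in Z j0 @^-1` A) (G w)%:E =
    ((\prod_(j < m | j != j0) c j)%:E * N01 A).
  move=> mA; pose F' j := if j == j0 then \1_A : R -> R else F j.
  pose c' j := if j == j0 then fine (N01 A) else c j.
  have NA : N01 A = (fine (N01 A))%:E.
    by rewrite fineK// fin_num_measure.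
  rewrite NA -EFinM.
  transitivity (\int[P]_w (\prod_(j < m) F' j (Z j w))%:E).
    rewrite integral_mkcond; apply: eq_integral => w _; rewrite patchE.
    rewrite (bigD1 j0)//= {1}/F' eqxx indicE.
    rewrite (_ : (w \in _) = (Z j0 w \in A))//.
    have -> : (\prod_(i < m | i != j0) F' i (Z i w))%R = G w.
      by apply: eq_bigr => j /negbTE jj0; rewrite /F' jj0.
    by case: ifP; rewrite ?mul1r ?mul0r.
  rewrite (IH F' c').
  - rewrite (bigD1 j0)//= {1}/c' eqxx mulrC; congr (_ * _)%R%:E.
    by apply: eq_bigr => j /negbTE jj0; rewrite /c' jj0.
  - by move=> j; rewrite /F'; case: ifP => // _; exact: measurable_indic.
  - by move=> j x; rewrite /F'; case: ifP => // _; rewrite indicE.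
  - by move=> j; rewrite /F' /c'; case: ifP => // _; rewrite integral_indic//= setIT.
  - move=> j kj; rewrite /F'; case: ifPn => [_|jj0]; first by exists A.
    apply: Find; rewrite ltn_neqAle kj andbT.
    by apply: contra jj0 => /eqP kj'; apply/eqP/val_inj.
transitivity (\int[P]_w ((F j0 (Z j0 w))%:E * (G w)%:E)).
  by apply: eq_integral => w _; rewrite (bigD1 j0).
rewrite -(@ge0_integral_transfer _ _ _ _ _ P
  (mscale (NngNum K0) N01) (Z j0) G (fun x => (F j0 x)%:E)) //.
- rewrite ge0_integral_mscale//=.
  + by rewrite Fc -EFinM [in RHS](bigD1 j0)//= mulrC.
  + by apply/measurable_EFinP; exact: mF.
  + by move=> x _; rewrite lee_fin.
- exact: mZ.
- by move=> A mA; rewrite key.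
- by apply/measurable_EFinP; exact: mF.
- by move=> x; rewrite lee_fin.
Qed.

Implicit Types c : 'I_m -> R.

(** The Cameron-Martin density of the law of Z + c, read as a random variable on [Omega] rather than
    as a function on R^m. *)
Definition gauss_tilt c (w : Omega) : R :=
  expR (\sum_(j < m) c j * Z j w - (\sum_(j < m) c j ^+ 2) / 2).

Lemma gauss_tiltE c w :
  gauss_tilt c w = (\prod_(j < m) expR (c j * Z j w - c j ^+ 2 / 2))%R.
Proof. by rewrite -expR_sum sumrB -mulr_suml. Qed.

Lemma measurable_gauss_tilt c : measurable_fun setT (gauss_tilt c).
Proof.
apply: measurableT_comp => //; apply: measurable_funB => //.
by apply: measurable_sum => j; exact: measurable_funM.
Qed.

Lemma gauss_tilt_ge0 c w : (0 <= gauss_tilt c w)%R. Proof. exact: expR_ge0. Qed.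

Definition ztup (w : Omega) : m.-tuple R := [tuple Z j w | j < m].

Lemma measurable_ztup : measurable_fun setT ztup.
Proof.
apply/measurable_fun_tnthP => j.
by rewrite [X in measurable_fun _ X](_ : _ = Z j)//; apply/funext => w /=; rewrite tnth_mktuple.
Qed.

Definition zshift c (w : Omega) : m.-tuple R := [tuple (Z j w + c j)%R | j < m].

Lemma measurable_zshift c : measurable_fun setT (zshift c).
Proof.
apply/measurable_fun_tnthP => j.
rewrite [X in measurable_fun _ X](_ : _ = fun w => (Z j w + c j)%R).
  exact: measurable_funD.
by apply/funext => w /=; rewrite tnth_mktuple.
Qed.

(** A generating family stable under intersection, made of the sets on which [iid_std_normal] gives
    information. *)
Definition boxes : set (set (m.-tuple R)) :=
  [set B | exists2 A : 'I_m -> set R, (forall j, measurable (A j)) &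
     B = [set t | forall j, A j (tnth t j)]].

Lemma measurable_boxes : @measurable _ (m.-tuple R) = <<s boxes >>.
Proof.
apply/seteqP; split.
  apply: smallest_sub; first exact: smallest_sigma_algebra.
  rewrite -bigcup_seq => _ [j _ [A mA <-]].
  apply: sub_sigma_algebra; exists (fun i => if i == j then A else setT).
    by move=> i; case: ifP.
  rewrite setTI; apply/seteqP; split => t /= => [Aj i|/(_ j)]; last by rewrite eqxx.
  by case: eqP => // ->.
apply: smallest_sub; first exact: sigma_algebra_measurable.
move=> _ [A mA ->].
rewrite [X in _ X](_ : _ = \bigcap_(j in [set: 'I_m]) ((@tnth _ _)^~ j @^-1` A j)).
  apply: fin_bigcap_measurable => // j _.
  by rewrite -[X in measurable X]setTI; exact: measurable_tnth.
by apply/seteqP; split => t /= h j; [move=> _|]; exact: h.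
Qed.

End gaussian_vector.

(** * Translation and exponential moments of the Gaussian vector *)

Section gaussian_shift.
Local Open Scope ereal_scope.
Context {R : realType} {dO : measure_display} {Omega : measurableType dO}
  (P : probability Omega R) {m : nat} (Z : 'I_m -> Omega -> R).
Hypothesis Ziid : iid_std_normal P Z.
Local Notation N01 := (@normal_prob R 0 1).
Implicit Types c : 'I_m -> R.

(** Both sides are measures in [B], the law of Z + c and the image of the tilted measure under
    [ztup]. They agree on boxes, where each factors into one-dimensional shifts, hence
    everywhere. *)
Lemma gauss_shift c (B : set (m.-tuple R)) : measurable B ->
  P (zshift Z c @^-1` B) = \int[P]_(w in ztup Z @^-1` B) (gauss_tilt Z c w)%:E.
Proof.
have [mZ PZ] := Ziid.
have [nu nuE] := density_measure_exists P (gauss_tilt Z c)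
  (measurable_gauss_tilt P Z Ziid c) (gauss_tilt_ge0 Z c).
have mzt := measurable_ztup P Z Ziid; have mzs := measurable_zshift P Z Ziid c.
move=> mB; rewrite -nuE; last by rewrite -[X in measurable X]setTI; exact: mzt.
rewrite -/(pushforward P (zshift Z c) B) -/(pushforward nu (ztup Z) B).
apply: (measure_unique boxes (fun=> setT)) => //.
- exact: measurable_boxes.
- move=> _ _ [A mA ->] [A' mA' ->]; exists (fun j => A j `&` A' j).
    by move=> j; exact: measurableI.
  apply/seteqP; split => t /=; first by move=> [tA tA'] j; split; [exact: tA|exact: tA'].
  by move=> tAA'; split=> j; have [] := tAA' j.
- by move=> _; exists (fun=> setT) => //; apply/seteqP; split.
- by apply/seteqP; split => // t _; exists 0%N.
- move=> _ [A mA ->]; rewrite /pushforward /=.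
  pose B0 := \bigcap_(j in [set: 'I_m]) (Z j @^-1` ((+%R^~ (c j)) @^-1` A j)).
  have mshift j : measurable ((+%R^~ (c j)) @^-1` A j).
    rewrite -[X in measurable X]setTI.
    have mf : measurable_fun setT (+%R^~ (c j) : R -> R) by exact: measurable_funD.
    exact: mf.
  transitivity (P B0).
    congr (P _); apply/seteqP; split => w /= h j.
      by move=> _; have := h j; rewrite tnth_mktuple.
    by rewrite tnth_mktuple; exact: h.
  apply: (eq_trans (PZ _ mshift)); apply: esym; apply: (eq_trans (nuE _ _)).
    rewrite -[X in measurable X]setTI; apply: mzt => //.
    by rewrite measurable_boxes; apply: sub_sigma_algebra; exists A.
  (* Indicator times one-dimensional likelihood ratio: the tilt factors over the coordinates, so the
     tilted integral over a box is an integral of a product. *)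
  pose F j x : R := (\1_(A j) x * expR (c j * x - c j ^+ 2 / 2))%R.
  have mF j : measurable_fun setT (F j).
    apply: measurable_funM; first exact: measurable_indic.
    by apply: measurableT_comp => //; apply: measurable_funB.
  have F0 j x : (0 <= F j x)%R by rewrite mulr_ge0 ?expR_ge0// indicE.
  have NF j : N01 ((+%R^~ (c j)) @^-1` A j) = \int[N01]_x (F j x)%:E.
    by rewrite normal_prob_shift.
  rewrite integral_mkcond; apply: esym.
  transitivity (\int[P]_w (\prod_(j < m) F j (Z j w))%:E).
    rewrite (integral_prod_coord P Z Ziid F
      (fun j => fine (N01 ((+%R^~ (c j)) @^-1` A j)))) //.
      rewrite -prodEFin; apply: eq_bigr => j _.
      by rewrite fineK// fin_num_measure//; exact: mshift.
    move=> j; rewrite -NF fineK// fin_num_measure//; exact: mshift.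
  apply: eq_integral => w _; rewrite patchE /F big_split/= gauss_tiltE.
  case: ifPn => [/set_mem /= wA|/negP wA].
    by rewrite big1 ?mul1r// => j _; rewrite indicE mem_set//; have := wA j; rewrite tnth_mktuple.
  have [j wj] : exists j, ~ A j (Z j w).
    apply/existsNP => h; apply: wA; apply/mem_set => j /=.
    by rewrite tnth_mktuple; exact: h.
  by rewrite (bigD1 j)//= indicE memNset// !mul0r.
- by move=> _ /=; rewrite /pushforward preimage_setT probability_setT ltry.
Qed.

Lemma integral_gauss_tilt c : \int[P]_w (gauss_tilt Z c w)%:E = 1.
Proof.
by have := gauss_shift c setT measurableT; rewrite !preimage_setT probability_setT.
Qed.

(** The integrand is a constant multiple of the tilt, whose integral is one. *)
Lemma integral_exp_lin c :
  \int[P]_w (expR (\sum_(j < m) c j * Z j w))%:E =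
  (expR ((\sum_(j < m) c j ^+ 2) / 2))%:E.
Proof.
set s := (\sum_(j < m) c j ^+ 2)%R.
have E w : expR (\sum_(j < m) c j * Z j w) = (expR (s / 2) * gauss_tilt Z c w)%R.
  by rewrite /gauss_tilt -expRD; congr expR; rewrite addrC subrK.
under eq_integral do rewrite E EFinM.
rewrite ge0_integralZl//; last 2 first.
- by apply/measurable_EFinP; exact: (measurable_gauss_tilt P Z Ziid).
- by move=> w _; rewrite lee_fin gauss_tilt_ge0.
by rewrite integral_gauss_tilt mule1.
Qed.

(** Raising to the power [lam] turns the linear part into that of [lam * c] but multiplies the
    quadratic part only by [lam]; the mismatch [lam ^+ 2 - lam] is the exponent. *)
Lemma integral_gauss_tilt_powR c (lam : R) :
  \int[P]_w ((gauss_tilt Z c w) `^ lam)%:E =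
  (expR (lam * (lam - 1) * (\sum_(j < m) c j ^+ 2) / 2))%:E.
Proof.
set s := (\sum_(j < m) c j ^+ 2)%R.
have E w : (gauss_tilt Z c w `^ lam =
    expR (- (lam * s / 2)) * expR (\sum_(j < m) (lam * c j) * Z j w))%R.
  rewrite /gauss_tilt -expRM -expRD; congr expR.
  under [X in _ = (_ + X)%R]eq_bigr do rewrite -mulrA.
  by rewrite -mulr_sumr -/s; ring.
under eq_integral do rewrite E EFinM.
rewrite ge0_integralZl//; last first.
  apply/measurable_EFinP; apply: measurableT_comp => //.
  apply: measurable_sum => j; apply: measurable_funM => //.
  by have [mZ _] := Ziid; exact: mZ.
rewrite integral_exp_lin -EFinM -expRD; congr (expR _)%:E.
under eq_bigr do rewrite exprMn.
by rewrite -mulr_sumr -/s; ring.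
Qed.

End gaussian_shift.

(** * Data processing inequality for power moments of densities *)

Section data_processing.
Local Open Scope ereal_scope.
Context {d1 d2 : measure_display} {X : measurableType d1} {Y : measurableType d2}
  {R : realType} (mu : {measure set X -> \bar R}) (nu rho : {measure set Y -> \bar R})
  (u : X -> Y) (L : X -> R) (g : Y -> R) (lam Lam : R).
Hypotheses (mu_ : measurable_fun setT u) (mL : measurable_fun setT L)
  (L0 : forall x, (0 <= L x)%R) (mg : measurable_fun setT g)
  (g0 : forall y, (0 <= g y)%R) (lam1 : (1 < lam)%R).
Hypothesis nu_fin : nu setT < +oo.
Hypothesis rhoE : forall A, measurable A -> rho A = mu (u @^-1` A).
Hypothesis nuL : forall A, measurable A -> nu A = \int[mu]_(x in u @^-1` A) (L x)%:E.
Hypothesis nug : forall A, measurable A -> nu A = \int[rho]_(y in A) (g y)%:E.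
Hypothesis LLam : \int[mu]_x (L x `^ lam)%:E = Lam%:E.

Let gk k y := Num.min (g y) k%:R.

Let gk0 k y : (0 <= gk k y)%R. Proof. by rewrite le_min g0 ler0n. Qed.

Let mgk k : measurable_fun setT (gk k). Proof. exact: measurable_minr. Qed.

Let mgkp k p : measurable_fun setT (fun y => gk k y `^ p)%R.
Proof. by apply: (measurableT_comp (measurable_powR p)). Qed.

Let integral_rho (F : Y -> \bar R) : measurable_fun setT F -> (forall y, 0 <= F y) ->
  \int[rho]_y F y = \int[mu]_x F (u x).
Proof.
move=> mF F0; rewrite (@ge0_integral_transfer _ _ _ _ _ mu rho u (cst 1%R)) //.
  by under eq_integral do rewrite mule1.
move=> A mA; rewrite rhoE// -[RHS]/(\int[mu]_(x in _) (cst 1) x) integral_cst ?mul1e//.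
by rewrite -[X in measurable X]setTI; exact: mu_.
Qed.

Let trunc_bound k : \int[nu]_y (gk k y `^ (lam - 1))%:E <= Lam%:E.
Proof.
have lam0 : (0 < lam)%R by move: lam1; lra.
have lam10 : (0 < lam - 1)%R by move: lam1; lra.
set A := \int[nu]_y _.
have A0 : 0 <= A by apply: integral_ge0 => y _; rewrite lee_fin powR_ge0.
(* The purpose of the truncation: [A] is finite, so it may be subtracted from both sides at the
   end. *)
have Afin : A \is a fin_num.
  rewrite ge0_fin_numE//.
  apply: (@le_lt_trans _ _ (\int[nu]_(y in setT) (k%:R `^ (lam - 1))%:E)).
    apply: ge0_le_integral => //.
    - by move=> y _; rewrite lee_fin powR_ge0.
    - exact/measurable_EFinP.
    - move=> y _; rewrite lee_fin; apply: ge0_ler_powR; rewrite ?nnegrE ?gk0 ?ler0n//.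
        exact: ltW.
      by rewrite ge_min lexx orbT.
  have nufin : nu setT \is a fin_num by rewrite ge0_fin_numE.
  by rewrite integral_cst// -(fineK nufin) -EFinM ltry.
have step1 : A <= (1 - lam^-1)%:E * A + (lam^-1 * Lam)%:E.
  rewrite {1}/A (@ge0_integral_transfer _ _ _ _ _ mu nu u L) //; last 2 first.
  - exact/measurable_EFinP.
  - by move=> y; rewrite lee_fin powR_ge0.
  have mint : measurable_fun setT (fun x => (gk k (u x) `^ lam)%:E).
    by apply/measurable_EFinP; exact: (measurableT_comp (mgkp k lam)).
  have mL' : measurable_fun setT (fun x => (L x `^ lam)%:E).
    by apply/measurable_EFinP; apply: (measurableT_comp (measurable_powR lam)).
  apply: (@le_trans _ _ (\int[mu]_x ((1 - lam^-1)%:E * (gk k (u x) `^ lam)%:E +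
      (lam^-1)%:E * (L x `^ lam)%:E))).
    apply: ge0_le_integral => //.
    - by move=> x _; rewrite mule_ge0// lee_fin ?powR_ge0.
    - apply: emeasurable_funM; apply/measurable_EFinP => //.
      exact: (measurableT_comp (mgkp k _)).
    - by apply: emeasurable_funD; apply: measurable_funeM.
    - move=> x _; rewrite -!EFinM -EFinD lee_fin.
      have := @conjugate_powR R (gk k (u x) `^ (lam - 1))%R (L x) (lam / (lam - 1))%R lam
        (powR_ge0 _ _) (L0 x) (divr_gt0 lam0 lam10) lam0.
      rewrite -powRrM.
      have -> : ((lam - 1) * (lam / (lam - 1)) = lam)%R by field; rewrite gt_eqF.
      have -> : ((lam / (lam - 1))^-1 = 1 - lam^-1)%R by field; rewrite !gt_eqF.
      by rewrite subrK => /(_ erefl) /le_trans; apply; rewrite lerD// mulrC.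
  have l1 : (0 <= 1 - lam^-1)%R by rewrite subr_ge0 invf_le1// ltW.
  rewrite ge0_integralD//; last 4 first.
  - by move=> x _; rewrite mule_ge0// lee_fin ?powR_ge0.
  - exact: measurable_funeM.
  - by move=> x _; rewrite mule_ge0// lee_fin ?powR_ge0// invr_ge0 ltW.
  - exact: measurable_funeM.
  rewrite !ge0_integralZl//; last 3 first.
  - by move=> x _; rewrite lee_fin powR_ge0.
  - by rewrite lee_fin invr_ge0 ltW.
  - by move=> x _; rewrite lee_fin powR_ge0.
  rewrite LLam -EFinM leeD2r// lee_wpmul2l ?lee_fin//.
  rewrite -(integral_rho (fun y => (gk k y `^ lam)%:E)); last 2 first.
  - exact/measurable_EFinP.
  - by move=> y; rewrite lee_fin powR_ge0.
  rewrite /A (@ge0_integral_transfer _ _ _ _ _ rho nu id g) //; last 2 first.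
  - exact/measurable_EFinP.
  - by move=> y; rewrite lee_fin powR_ge0.
  apply: ge0_le_integral => //.
  - by move=> y _; rewrite lee_fin powR_ge0.
  - exact/measurable_EFinP.
  - by apply: emeasurable_funM; apply/measurable_EFinP.
  move=> y _; rewrite -EFinM lee_fin.
  have [->|gn0] := eqVneq (gk k y) 0%R.
    by rewrite powR0 ?gt_eqF// mulr_ge0// powR_ge0.
  have -> : (gk k y `^ lam = gk k y `^ (lam - 1) * gk k y)%R.
    by rewrite -[X in (_ = _ * X)%R](powRr1 (gk0 k y)) -powRD ?subrK// gn0 implybT.
  by rewrite ler_wpM2l ?powR_ge0// ge_min lexx.
move: step1; rewrite -(fineK Afin) -EFinM -EFinD !lee_fin => step1.
have : (lam^-1 * fine A <= lam^-1 * Lam)%R by move: lam1; lra.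
by rewrite ler_pM2l// invr_gt0.
Qed.

(* The density [g] of [nu] with respect to the image measure [rho] of [mu] is
   the conditional expectation of [L] given [u]; testing it against its own
   truncated powers and using Young's inequality avoids conditional
   expectations. *)
Lemma data_processing_powR : \int[nu]_y (g y `^ (lam - 1))%:E <= Lam%:E.
Proof.
have lam10 : (0 <= lam - 1)%R by move: lam1; lra.
have gkcvg y : (gk k y `^ (lam - 1))%:E @[k --> \oo] --> (g y `^ (lam - 1))%:E.
  apply: cvg_near_cst; near=> k; congr (_ `^ _)%:E.
  apply/min_idPl; near: k; exact: nbhs_infty_ger.
have gknd y : {homo (fun k => (gk k y `^ (lam - 1))%:E) : a b / (a <= b)%N >-> a <= b}.
  move=> a b ab; rewrite lee_fin; apply: ge0_ler_powR; rewrite ?nnegrE ?gk0//.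
  by rewrite le_min ge_min lexx/= ge_min ler_nat ab orbT.
have mono := @cvg_monotone_convergence _ _ _ nu _ measurableT
   (fun k y => (gk k y `^ (lam - 1))%:E)
   (fun k => (measurable_EFinP _ _).2 (mgkp k _))
   (fun k y _ => powR_ge0 _ _) (fun y _ => gknd y).
rewrite (_ : \int[nu]_y _ = limn (fun k => \int[nu]_y (gk k y `^ (lam - 1))%:E)).
  apply: lime_le; first by apply/cvg_ex; eexists; exact: mono.
  by near=> k; exact: trunc_bound.
rewrite (cvg_lim _ mono)//; apply: eq_integral => y _.
by apply/esym/cvg_lim => //; exact: gkcvg.
Unshelve. all: end_near. Qed.

End data_processing.

(** * Divergence between images of a Gaussian vector and of its translate *)

Section renyi_gauss.
Local Open Scope ereal_scope.

Lemma pushforward_probability {R : realType} {d1 d2 : measure_display}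
    {X : measurableType d1} {Y : measurableType d2} (P : probability X R) (f : X -> Y) :
  measurable_fun setT f ->
  exists nu : probability Y R, (nu : set Y -> \bar R) = pushforward P f.
Proof.
move=> mf; pose mixin := isMeasurableFun.Build _ _ _ _ _ mf.
pose X' : {mfun X >-> Y} := HB.pack f mixin.
by exists [the probability Y R of distribution P X'].
Qed.

(** The Radon-Nikodym derivative is extended real but finite at every point; [fine] makes it the
    real function that [density_of] asks for. *)
Lemma density_exists {R : realType} {d : measure_display} {Y : measurableType d}
    (nu rho : probability Y R) : nu `<< rho -> exists f, density_of nu rho f.
Proof.
move=> nurho.
have [f [f0 ffin fint fE]] := @radon_nikodym_sigma_finite _ _ _ rho nu nurho.
exists (fine \o f); split => [|t|A mA].
- apply: measurableT_comp => //; exact: measurable_int fint.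
- exact: fine_ge0.
- by rewrite fE//; apply: eq_integral => y _; rewrite /= fineK.
Qed.

Context {R : realType} {dO : measure_display} {Omega : measurableType dO}
  (P : probability Omega R) {m : nat} (Z : 'I_m -> Omega -> R)
  {d : measure_display} {Y : measurableType d}.
Hypothesis Ziid : iid_std_normal P Z.

Lemma renyi_star_gauss_shift (H : m.-tuple R -> Y) (c : 'I_m -> R) :
  measurable_fun setT H ->
  renyi_star (pushforward P (H \o zshift Z c)) (pushforward P (H \o ztup Z)) <=
  ((\sum_(j < m) c j ^+ 2) / 2)%:E.
Proof.
move=> mH.
have mu_ : measurable_fun setT (H \o ztup Z).
  exact: (measurableT_comp mH (measurable_ztup P Z Ziid)).
have mv : measurable_fun setT (H \o zshift Z c).
  exact: (measurableT_comp mH (measurable_zshift P Z Ziid c)).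
have [nu nuE] := pushforward_probability P _ mv.
have [rho rhoE] := pushforward_probability P _ mu_.
have nuL A : measurable A ->
    nu A = \int[P]_(w in (H \o ztup Z) @^-1` A) (gauss_tilt Z c w)%:E.
  move=> mA; rewrite nuE /pushforward comp_preimage.
  apply: (eq_trans (gauss_shift P Z Ziid c (H @^-1` A) _)) => //.
  by rewrite -[X in measurable X]setTI; exact: mH.
(* A set null for [rho] has a [P]-null preimage, over which the tilt integrates to zero. Hence [nu]
   is dominated by [rho], and [renyi] does not fall into its [+oo] branch. *)
have [f fdens] : exists f, density_of nu rho f.
  apply: density_exists; apply/null_content_dominatesP => A mA rhoA.
  rewrite nuL//; apply: null_set_integral => //.
  - by rewrite -[X in measurable X]setTI; exact: mu_.
  - apply/measurable_EFinP; apply: measurable_funTS.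
    exact: (measurable_gauss_tilt P Z Ziid).
  - exact: (eq_trans (esym (congr1 (fun h => h A) rhoE)) rhoA).
rewrite -nuE -rhoE; apply: ge_ereal_sup => _ [lam lam1 ->].
have lam0 : (0 < lam)%R by rewrite (lt_trans _ lam1).
have lam10 : (0 < lam - 1)%R by rewrite subr_gt0.
rewrite /renyi; case: pselect => [h|]; last by case; exists f.
case: (cid h) => g [mg g0 nug] /=.
have := data_processing_powR P nu rho _ _ _ lam _ mu_ (measurable_gauss_tilt P Z Ziid c)
  (gauss_tilt_ge0 Z c) mg g0 lam1.
move=> /(_ _ _ _ nuL nug (integral_gauss_tilt_powR P Z Ziid c lam)).
set I := \int[nu]_y _ => Ile.
have {}Ile : I <= (expR (lam * (lam - 1) * (\sum_(j < m) c j ^+ 2) / 2))%:E.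
  apply: Ile; first exact: (le_lt_trans (probability_le1 nu measurableT) (ltry _)).
  by move=> A mA; exact: (congr1 (fun h => h A) rhoE).
have I0 : 0 <= I by apply: integral_ge0 => y _; rewrite lee_fin powR_ge0.
have : lne I <= (lam * (lam - 1) * (\sum_(j < m) c j ^+ 2) / 2)%:E.
  rewrite -[leRHS]expeRK lee_lne; first exact: Ile.
    by rewrite in_itv/= I0 leey.
  by rewrite in_itv/= leey andbT lee_fin expR_ge0.
move=> lneI.
(* The factors [lam^-1] and [(lam - 1)^-1] cancel the exponent exactly, so the bound does not depend
   on [lam] and passes to the supremum. *)
apply: (@le_trans _ _ ((lam^-1)%:E * (((lam - 1)^-1)%:E *
    (lam * (lam - 1) * (\sum_(j < m) c j ^+ 2) / 2)%:E))).
  by rewrite !lee_wpmul2l// lee_fin invr_ge0 ltW.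
rewrite -!EFinM lee_fin le_eqVlt; apply/orP; left; apply/eqP.
by clear nuE rhoE; field; rewrite !gt_eqF.
Qed.
End renyi_gauss.

(** * Euclidean geometry of R^m *)

Section euclidean.
Context {R : realType} {m : nat}.
Implicit Types (u v w : 'I_m -> R) (t : R).

Definition dot u v : R := \sum_(j < m) u j * v j.
Definition nsq u : R := dot u u.
Definition norm2 u : R := Num.sqrt (nsq u).

Lemma dotC u v : dot u v = dot v u.
Proof. by apply: eq_bigr => j _; rewrite mulrC. Qed.

Lemma dotDl u v w : dot (u + v) w = dot u w + dot v w.
Proof. by rewrite -big_split; apply: eq_bigr => j _; rewrite fctE mulrDl. Qed.

Lemma dotNl u w : dot (- u) w = - dot u w.
Proof. by rewrite -sumrN; apply: eq_bigr => j _; rewrite fctE mulNr. Qed.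

Lemma dotZl t u w : dot (t *: u) w = t * dot u w.
Proof. by rewrite mulr_sumr; apply: eq_bigr => j _; rewrite mulrA. Qed.

Lemma dotDr u v w : dot w (u + v) = dot w u + dot w v.
Proof. by rewrite !(dotC w) dotDl. Qed.

Lemma dotNr u w : dot w (- u) = - dot w u.
Proof. by rewrite !(dotC w) dotNl. Qed.

Lemma dotZr t u w : dot w (t *: u) = t * dot w u.
Proof. by rewrite !(dotC w) dotZl. Qed.

Definition dotE := (dotDl, dotDr, dotNl, dotNr, dotZl, dotZr).

Lemma nsq_ge0 u : 0 <= nsq u.
Proof. by apply: sumr_ge0 => j _; rewrite -expr2 sqr_ge0. Qed.

Lemma norm2_ge0 u : 0 <= norm2 u. Proof. exact: sqrtr_ge0. Qed.

Lemma sqr_norm2 u : norm2 u ^+ 2 = nsq u.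
Proof. by rewrite sqr_sqrtr ?nsq_ge0. Qed.

Lemma ler_norm2 u v : (norm2 u <= norm2 v) = (nsq u <= nsq v).
Proof. by rewrite ler_sqrt ?nsq_ge0. Qed.

Lemma normr_coord_le u j : `|u j| <= norm2 u.
Proof.
rewrite -sqrtr_sqr ler_sqrt ?nsq_ge0// /nsq /dot (bigD1 j)//= expr2 lerDl.
by apply: sumr_ge0 => i _; rewrite -expr2 sqr_ge0.
Qed.

Lemma cauchy_schwarz u v : dot u v <= norm2 u * norm2 v.
Proof.
have [v0|v0] := eqVneq (nsq v) 0.
  rewrite /dot big1 ?mulr_ge0 ?norm2_ge0// => j _.
  have : `|v j| <= 0 by rewrite (le_trans (normr_coord_le v j))// /norm2 v0 sqrtr0.
  by rewrite normr_le0 => /eqP ->; rewrite mulr0.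
have v1 : 0 < nsq v by rewrite lt_neqAle eq_sym v0 nsq_ge0.
rewrite -sqrtrM ?nsq_ge0//; apply: le_trans (ler_norm _) _.
rewrite -sqrtr_sqr ler_sqrt ?mulr_ge0 ?nsq_ge0//.
have := nsq_ge0 (nsq v *: u - dot u v *: v).
rewrite /nsq !dotE (dotC v u) -/(nsq v) -/(nsq u) => h.
by rewrite -(ler_pM2l v1); nra.
Qed.

Lemma norm2D u v : norm2 (u + v) <= norm2 u + norm2 v.
Proof.
rewrite -ler_sqr ?nnegrE ?addr_ge0 ?norm2_ge0//.
rewrite sqrrD !sqr_norm2 /nsq !dotE (dotC v u).
by have := cauchy_schwarz u v; rewrite -mulr_natl; lra.
Qed.

Lemma nsqN u : nsq (- u) = nsq u. Proof. by rewrite /nsq !dotE opprK. Qed.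

Lemma norm2N u : norm2 (- u) = norm2 u. Proof. by rewrite /norm2 nsqN. Qed.

Lemma norm2B u v : norm2 (u - v) = norm2 (v - u).
Proof. by rewrite -norm2N opprB. Qed.

Lemma norm2Z t u : norm2 (t *: u) = `|t| * norm2 u.
Proof. by rewrite /norm2 /nsq !dotE mulrA -expr2 sqrtrM ?sqr_ge0// sqrtr_sqr. Qed.

Lemma nsqDZ t u v : nsq (u + t *: v) = nsq u + t * (2 * dot u v + t * nsq v).
Proof. by rewrite /nsq !dotE (dotC v u); ring. Qed.

(** The parallelogram law in midpoint form, for the convergence of minimizing sequences. *)
Lemma nsqB_midpoint u v :
  nsq (u - v) = 2 * nsq u + 2 * nsq v - 4 * nsq (2^-1 *: (u + v)).
Proof. by rewrite /nsq !dotE (dotC v u); field. Qed.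

Lemma norm2_le_sum u : norm2 u <= \sum_(j < m) `|u j|.
Proof.
have s0 : 0 <= \sum_(j < m) `|u j| by apply: sumr_ge0.
rewrite -(ler_sqr (norm2_ge0 u) s0) sqr_norm2 expr2 mulr_suml.
apply: ler_sum => j _; rewrite (le_trans (ler_norm _))// normrM ler_wpM2l//.
by rewrite (bigD1 j)//= lerDl sumr_ge0.
Qed.

Lemma norm2_sum (I : Type) (s : seq I) (F : I -> 'I_m -> R) :
  norm2 (\sum_(i <- s) F i) <= \sum_(i <- s) norm2 (F i).
Proof.
elim: s => [|i s IH]; first by rewrite !big_nil /norm2 /nsq /dot big1 ?sqrtr0// => j _; rewrite mul0r.
by rewrite !big_cons (le_trans (norm2D _ _))// lerD2l.
Qed.

(* Vectors of [R^m] in the statement are tuples; the algebra is carried out on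
   the functions [tnth p], which form an [lmodType]. *)
Definition mkvec u : m.-tuple R := [tuple u j | j < m].

Lemma tnth_mkvec u : tnth (mkvec u) = u.
Proof. by apply/funext => j; rewrite tnth_mktuple. Qed.

Lemma vnorm_vsub (p q : m.-tuple R) : vnorm (vsub p q) = norm2 (tnth p - tnth q).
Proof.
by congr Num.sqrt; apply: eq_bigr => j _; rewrite tnth_mktuple expr2.
Qed.

End euclidean.

(** * Convex hulls and their closures *)

Section convex_hull.
Local Notation conv := Defs.conv.
Context {R : realType} {m : nat}.
Implicit Types (S : set (m.-tuple R)) (p q y z : m.-tuple R) (t : R).

Lemma sub_conv S p : S p -> conv S p.
Proof.
move=> Sp; exists 1%N, (fun=> 1), (fun=> p); split => //; rewrite ?big_ord1//.
by apply: eq_from_tnth => j; rewrite tnth_mktuple big_ord1 mul1r.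
Qed.

Lemma conv_convex S p q t : conv S p -> conv S q -> 0 <= t -> t <= 1 ->
  conv S (mkvec ((1 - t) *: tnth p + t *: tnth q)).
Proof.
move=> [k [w [a [w0 w1 Sa ->]]]] [l [v [b [v0 v1 Sb ->]]]] t0 t1.
exists (k + l)%N, (fun i => match fintype.split i with inl i1 => (1 - t) * w i1 | inr i2 => t * v i2 end),
  (fun i => match fintype.split i with inl i1 => a i1 | inr i2 => b i2 end); split.
- by move=> i; case: splitP => i' _; rewrite mulr_ge0// subr_ge0.
- rewrite big_split_ord /=.
  under eq_bigr do rewrite (unsplitK (inl _)).
  under [X in _ + X]eq_bigr do rewrite (unsplitK (inr _)).
  by rewrite -!mulr_sumr w1 v1; ring.
- by move=> i; case: splitP.
- apply: eq_from_tnth => j; rewrite !tnth_mktuple big_split_ord /= fctE /=.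
  under [X in _ = X + _]eq_bigr do rewrite (unsplitK (inl _)) -mulrA.
  under [X in _ = _ + X]eq_bigr do rewrite (unsplitK (inr _)) -mulrA.
  by rewrite -!mulr_sumr !fctE !tnth_mktuple.
Qed.

Lemma dot_conv_le S (a : 'I_m -> R) (B : R) :
  (forall s, S s -> dot a (tnth s) <= B) -> forall z, conv S z -> dot a (tnth z) <= B.
Proof.
move=> aB _ [k [w [p [w0 w1 Sp ->]]]].
rewrite -(mul1r B) -w1 mulr_suml.
rewrite [leLHS](_ : _ = \sum_(i < k) w i * dot a (tnth (p i))).
  by apply: ler_sum => i _; rewrite ler_wpM2l// aB.
under [RHS]eq_bigr do rewrite mulr_sumr.
rewrite exchange_big; apply: eq_bigr => j _ /=; rewrite tnth_mktuple mulr_sumr.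
by apply: eq_bigr => i _; rewrite mulrCA.
Qed.

Lemma sub_vclosure (C : set (m.-tuple R)) p : C p -> vclosure C p.
Proof.
move=> Cp e e0; exists p => //; rewrite vnorm_vsub subrr.
by rewrite /norm2 /nsq /dot big1 ?sqrtr0// => j _; rewrite mul0r.
Qed.

Lemma vclosure_conv_convex S p q t :
  vclosure (conv S) p -> vclosure (conv S) q -> 0 <= t -> t <= 1 ->
  vclosure (conv S) (mkvec ((1 - t) *: tnth p + t *: tnth q)).
Proof.
move=> Cp Cq t0 t1 e e0; have [p' Cp' pp'] := Cp _ e0; have [q' Cq' qq'] := Cq _ e0.
exists (mkvec ((1 - t) *: tnth p' + t *: tnth q')); first exact: conv_convex.
rewrite !vnorm_vsub in pp' qq' *; rewrite !tnth_mkvec.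
have -> : (1 - t) *: tnth p + t *: tnth q - ((1 - t) *: tnth p' + t *: tnth q') =
    (1 - t) *: (tnth p - tnth p') + t *: (tnth q - tnth q').
  by apply/funext => j; rewrite !fctE; ring.
have t1' : 0 <= 1 - t by rewrite subr_ge0.
apply: le_lt_trans (norm2D _ _) _; rewrite !norm2Z !ger0_norm//.
have [->|tn0] := eqVneq t 0; first by rewrite subr0 mul1r mul0r addr0.
have tp : 0 < t by rewrite lt_neqAle eq_sym tn0.
have : t * norm2 (tnth q - tnth q') < t * e by rewrite ltr_pM2l.
have : (1 - t) * norm2 (tnth p - tnth p') <= (1 - t) * e by rewrite ler_wpM2l// ltW.
by lra.
Qed.

Lemma dot_vclosure_conv_le S (a : 'I_m -> R) (B : R) :
  (forall s, S s -> dot a (tnth s) <= B) ->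
  forall z, vclosure (conv S) z -> dot a (tnth z) <= B.
Proof.
move=> aB z Cz; apply/ler_addgt0Pr => e e0.
have a1 : 0 < norm2 a + 1 by rewrite ltr_wpDl ?norm2_ge0.
have [z' Cz' zz'] := Cz _ (divr_gt0 e0 a1).
have -> : tnth z = tnth z' + (tnth z - tnth z') by rewrite addrC subrK.
rewrite dotE lerD ?(dot_conv_le _ _ _ aB)//.
apply: le_trans (cauchy_schwarz _ _) _; rewrite vnorm_vsub in zz'.
apply: le_trans (_ : (norm2 a + 1) * (e / (norm2 a + 1)) <= e).
  by rewrite ler_pM ?norm2_ge0 ?lerDl// ltW.
by rewrite mulrC divfK ?gt_eqF.
Qed.

(** The minimality clause of [hull_proj] compares only with points of [conv S]; this extends it to
    the closure, which contains the projection and the segments issuing from it. *)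
Lemma vclosure_conv_dist_ge S y (r : R) :
  (forall z, conv S z -> r <= norm2 (tnth z - tnth y)) ->
  forall z, vclosure (conv S) z -> r <= norm2 (tnth z - tnth y).
Proof.
move=> rle z Cz; apply/ler_addgt0Pr => e e0.
have [z' Cz' zz'] := Cz _ e0; rewrite vnorm_vsub norm2B in zz'.
apply: le_trans (rle _ Cz') _.
have -> : tnth z' - tnth y = (tnth z - tnth y) + (tnth z' - tnth z).
  by apply/funext => j; rewrite !fctE; ring.
by rewrite (le_trans (norm2D _ _))// lerD2l ltW.
Qed.

End convex_hull.

(** * Existence and variational properties of the projection *)

Section projection.
Local Notation conv := Defs.conv.
Context {R : realType} {m : nat}.
Implicit Types (S : set (m.-tuple R)) (p q y z : m.-tuple R) (t : R).

(** A minimizing sequence is Cauchy: midpoints stay in the hull, so the parallelogram law bounds the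
    distance of two near-minimizers by their excess over the infimum. *)
Lemma exists_nearest S y : S !=set0 ->
  exists p, vclosure (conv S) p /\
    forall z, conv S z -> norm2 (tnth p - tnth y) <= norm2 (tnth z - tnth y).
Proof.
move=> [s Ss].
pose E := [set r | exists2 z, conv S z & r = nsq (tnth z - tnth y)].
have E0 : has_inf E.
  split; first by exists (nsq (tnth s - tnth y)), s => //; exact: sub_conv.
  by exists 0 => _ [z _ ->]; exact: nsq_ge0.
have Dle z : conv S z -> inf E <= nsq (tnth z - tnth y).
  by move=> Cz; apply: ge_inf; [exact: E0.2|exists z].
have /choice[z zP] : forall k, exists z, conv S z /\
    nsq (tnth z - tnth y) < inf E + k.+1%:R^-1.
  move=> k; have k0 : 0 < k.+1%:R^-1 :> R by rewrite invr_gt0.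
  by have [_ [z Cz ->] zlt] := inf_adherent k0 E0; exists z.
(* Two squared distances, each within 1/(N+1) of the infimum [D], give [2 * (D + 1/(N+1)) + 2 * (D +
   1/(N+1)) - 4 * D]. *)
have near_z N k : (N <= k)%N -> nsq (tnth (z N) - tnth (z k)) <= 4 * N.+1%:R^-1.
  move=> Nk; have [CN zN] := zP N; have [Ck zk] := zP k.
  have half0 : 0 <= 2^-1 :> R by [].
  have half1 : 2^-1 <= 1 :> R by lra.
  have := Dle _ (conv_convex _ _ _ _ CN Ck half0 half1).
  have kN : k.+1%:R^-1 <= N.+1%:R^-1 :> R by rewrite lef_pV2 ?posrE// ler_nat ltnS.
  set a := tnth (z N) - tnth y in zN *; set b := tnth (z k) - tnth y in zk *.
  have -> : tnth (z N) - tnth (z k) = a - b.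
    by apply/funext => j; rewrite /a /b !fctE; ring.
  rewrite tnth_mkvec.
  have -> : (1 - 2^-1) *: tnth (z N) + 2^-1 *: tnth (z k) - tnth y = 2^-1 *: (a + b).
    by apply/funext => j; rewrite /a /b !fctE /GRing.scale /=; field.
  rewrite (nsqB_midpoint a b); move: zN zk kN.
  move: (N.+1%:R^-1) (k.+1%:R^-1) (nsq a) (nsq b) (inf E) => iN ik na nb D.
  by move: (nsq _) => nab; lra.
have cvgz j : cvgn (fun k => tnth (z k) j).
  apply: cauchy_cvg; apply: cauchy_exP => e e0.
  have e4 : 0 < e ^+ 2 / 4 by rewrite divr_gt0// exprn_gt0.
  have [N _ /(_ N (leqnn N)) HN] := near_infty_natSinv_lt (PosNum e4).
  exists (tnth (z N) j); exists N => // k Nk /=.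
  have := normr_coord_le (tnth (z N) - tnth (z k)) j; rewrite fctE.
  move=> /le_lt_trans; apply.
  rewrite -(ltr_pXn2r (_ : (0 < 2)%N)) ?nnegrE ?norm2_ge0 ?(ltW e0)//.
  rewrite sqr_norm2; apply: le_lt_trans (near_z _ _ Nk) _.
  by rewrite mulrC -ltr_pdivlMr//; exact: HN.
pose p : m.-tuple R := mkvec (fun j => limn (fun k => tnth (z k) j)).
have near_p e : 0 < e -> \forall k \near \oo, norm2 (tnth p - tnth (z k)) < e.
  move=> e0.
  (* With [m.+1] instead of [m] the quotient is also meaningful for [m = 0], and the sum of [m] such
     terms stays strictly below [e]. *)
  have em : 0 < e / m.+1%:R by rewrite divr_gt0.
  have H : \forall k \near \oo, forall j, `|tnth p j - tnth (z k) j| < e / m.+1%:R.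
    apply: filter_forall => j; rewrite tnth_mkvec.
    by move/cvgrPdist_lt : (cvgz j) => /(_ _ em).
  apply: filterS H => k Hk; apply: le_lt_trans (norm2_le_sum _) _.
  apply: (@le_lt_trans _ _ (\sum_(j < m) (e / m.+1%:R))).
    by apply: ler_sum => j _; exact: ltW (Hk j).
  rewrite sumr_const card_ord -[ltLHS]mulr_natl mulrCA gtr_pMr//.
  by rewrite ltr_pdivrMr ?mul1r ?ltr_nat.
exists p; split.
  move=> e /near_p[N _ /(_ N (leqnn N)) HN]; exists (z N); first exact: (zP N).1.
  by rewrite vnorm_vsub.
move=> x Cx; apply/ler_addgt0Pr => e e0.
have e2 : 0 < e / 2 by rewrite divr_gt0.
have e4 : 0 < (e / 2) ^+ 2 by rewrite exprn_gt0.
near \oo => k.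
have kp : norm2 (tnth p - tnth (z k)) < e / 2 by near: k; exact: near_p.
have ke : k.+1%:R^-1 < (e / 2) ^+ 2.
  by near: k; exact: (near_infty_natSinv_lt (PosNum e4)).
have : norm2 (tnth (z k) - tnth y) <= norm2 (tnth x - tnth y) + e / 2.
  have nx := norm2_ge0 (tnth x - tnth y).
  rewrite -ler_sqr ?nnegrE ?norm2_ge0 ?addr_ge0 ?(ltW e2)//.
  rewrite sqrrD !sqr_norm2.
  set c := norm2 _ * _ *+ 2.
  have c0 : 0 <= c by rewrite mulrn_wge0// mulr_ge0// ltW.
  move: c0 ke (zP k).2 (Dle _ Cx); move: c (k.+1%:R^-1) ((e / 2) ^+ 2).
  by move: (inf E) (nsq _) (nsq (tnth (z k) - _)) => *; lra.
have -> : tnth p - tnth y = (tnth p - tnth (z k)) + (tnth (z k) - tnth y).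
  by apply/funext => j; rewrite !fctE; ring.
by have := norm2D (tnth p - tnth (z k)) (tnth (z k) - tnth y); lra.
Unshelve. all: by end_near. Qed.

(** Existence of a minimizer rules out the default value [y] of [xget]. *)
Lemma hull_projP S y : S !=set0 -> vclosure (conv S) (hull_proj S y) /\
  forall z, vclosure (conv S) z ->
    norm2 (tnth (hull_proj S y) - tnth y) <= norm2 (tnth z - tnth y).
Proof.
move=> S0; have [p [Cp pmin]] := exists_nearest S y S0.
rewrite /hull_proj; set A := [set p | _].
have : A (xget y A).
  apply: (@xgetPex _ y A); exists p; split => // z Cz.
  by rewrite !vnorm_vsub; exact: pmin.
move=> [Cq qmin]; split => //; apply: vclosure_conv_dist_ge => z Cz.
by rewrite -!vnorm_vsub; exact: qmin.
Qed.

(** Otherwise a small move from the projection towards [z], which stays in the closed hull, would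
    come closer to [y]. *)
Lemma hull_proj_obtuse S y z : S !=set0 -> vclosure (conv S) z ->
  0 <= dot (tnth (hull_proj S y) - tnth y) (tnth z - tnth (hull_proj S y)).
Proof.
move=> S0 Cz; have [Cp pmin] := hull_projP S y S0.
set p := hull_proj S y in Cp pmin *.
set a := tnth p - tnth y; set b := tnth z - tnth p.
rewrite leNgt; apply/negP => ab0.
have nb := nsq_ge0 b.
have nb1 : 0 < nsq b + 1 by rewrite ltr_wpDl.
(* This makes [t * nsq b <= - dot a b - t], hence [2 * dot a b + t * nsq b < 0], the sign of the
   increment in [nsqDZ]. The [+ 1] covers [b = 0], the minimum keeps the point on the segment. *)
pose t := Num.min 1 (- dot a b / (nsq b + 1)).
have t0 : 0 < t by rewrite lt_min ltr01 divr_gt0// oppr_gt0.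
have t1 : t <= 1 by rewrite ge_min lexx.
have tb : t * (nsq b + 1) <= - dot a b by rewrite -ler_pdivlMr// ge_min lexx orbT.
have := pmin _ (vclosure_conv_convex _ _ _ _ Cp Cz (ltW t0) t1).
rewrite tnth_mkvec.
have -> : (1 - t) *: tnth p + t *: tnth z - tnth y = a + t *: b.
  by apply/funext => j; rewrite /a /b !fctE /GRing.scale/=; ring.
rewrite ler_norm2 nsqDZ.
apply/negP; rewrite -ltNge gtrDl pmulr_rlt0//.
by move: tb; rewrite mulrDr mulr1; lra.
Qed.

(** Adding the obtuse-angle inequalities at the two projections gives
    [nsq (p - p') <= dot (p - p') (y - y')]; the nonnegative square [h3] then plays the part of
    Cauchy-Schwarz. *)
Lemma hull_proj_nonexpansive S y y' : S !=set0 ->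
  norm2 (tnth (hull_proj S y) - tnth (hull_proj S y')) <= norm2 (tnth y - tnth y').
Proof.
move=> S0; have [Cp _] := hull_projP S y S0; have [Cp' _] := hull_projP S y' S0.
have := hull_proj_obtuse S y _ S0 Cp'; have := hull_proj_obtuse S y' _ S0 Cp.
set p := tnth (hull_proj S y); set p' := tnth (hull_proj S y').
move=> h1 h2; rewrite ler_norm2.
have h3 := nsq_ge0 ((p - p') - (tnth y - tnth y')).
move: h1 h2 h3; rewrite /nsq !dotE.
rewrite !(dotC p' p) !(dotC _ p) !(dotC _ p') !(dotC (tnth y') (tnth y)).
by lra.
Qed.

Lemma hull_proj_dist S y q : S !=set0 -> vclosure (conv S) q ->
  nsq (tnth (hull_proj S y) - tnth q) <=
  dot (tnth y - tnth q) (tnth (hull_proj S y) - tnth q).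
Proof.
move=> S0 Cq; have := hull_proj_obtuse S y _ S0 Cq.
set p := tnth (hull_proj S y); rewrite /nsq !dotE.
by rewrite !(dotC _ p) !(dotC _ (tnth q)); lra.
Qed.

End projection.

(** * Measurability of the projection *)

Section measurable_projection.
Context {R : realType} {m : nat}.

(** Enumerates the rational points; integers that decode to nothing give 0. *)
Let rvec (i : nat) : m.-tuple R :=
  if unpickle i is Some q then mkvec (fun j => ratr (tnth (q : m.-tuple rat) j)) else mkvec 0.

Let rvec_dense (y : m.-tuple R) (e : R) : 0 < e ->
  exists i, norm2 (tnth y - tnth (rvec i)) < e.
Proof.
move=> e0; have em : 0 < e / m.+1%:R by rewrite divr_gt0.
have /choice[q qP] : forall j, exists q : rat,
    `|tnth y j - ratr q| < e / m.+1%:R.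
  move=> j; have ylt : tnth y j < tnth y j + e / m.+1%:R by rewrite ltrDl.
  have [q] := rat_in_itvoo ylt; rewrite in_itv/= => /andP[yq qy].
  by exists q; rewrite distrC gtr0_norm ?subr_gt0// ltrBlDl.
exists (pickle [tuple q j | j < m]); rewrite /rvec pickleK tnth_mkvec.
apply: le_lt_trans (norm2_le_sum _) _.
apply: (@le_lt_trans _ _ (\sum_(j < m) (e / m.+1%:R))).
  by apply: ler_sum => j _; rewrite !fctE tnth_mktuple ltW.
rewrite sumr_const card_ord -[ltLHS]mulr_natl mulrCA gtr_pMr//.
by rewrite ltr_pdivrMr ?mul1r ?ltr_nat.
Qed.

Lemma measurable_norm2_dist (u : 'I_m -> R) :
  measurable_fun setT (fun y : m.-tuple R => norm2 (tnth y - u)).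
Proof.
apply: (measurableT_comp (continuous_measurable_fun (@sqrt_continuous R))).
apply: measurable_sum => j.
have mj : measurable_fun setT (fun y : m.-tuple R => tnth y j - u j).
  by apply: measurable_funB => //; exact: measurable_tnth.
exact: measurable_funM.
Qed.

(* McShane's formula restricted to a countable dense set of centres. *)
Lemma lipschitz_measurable (f : m.-tuple R -> R) :
  (forall y z, f y <= f z + norm2 (tnth y - tnth z)) -> measurable_fun setT f.
Proof.
move=> fL; pose h i y := f (rvec i) + norm2 (tnth y - tnth (rvec i)).
have hlb y : has_lbound (range (h ^~ y)).
  by exists (f y) => _ [i _ <-]; exact: fL.
(* From index 0, [infs] is the infimum over all centres. A centre within [e / 2] of [y] costs its
   distance twice, once in [h] and once in the Lipschitz bound, hence at most [e]. *)
have -> : f = fun y => infs (h ^~ y) 0%N.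
  apply/funext => y; rewrite /infs.
  have S0 : sdrop (h^~ y) 0%N !=set0 by exists (h 0%N y), 0%N.
  have lbS : has_lbound (sdrop (h^~ y) 0%N).
    by exists (f y) => _ [i _ <-]; exact: fL.
  apply/eqP; rewrite eq_le; apply/andP; split.
    by apply: lb_le_inf => // _ [i _ <-]; exact: fL.
  apply/ler_addgt0Pr => e e0.
  have e2 : 0 < e / 2 by rewrite divr_gt0.
  have [i yi] := rvec_dense y _ e2.
  apply: le_trans (_ : h i y <= _); first by apply: ge_inf => //; exists i.
  have := fL (rvec i) y; rewrite norm2B /h => fr.
  by lra.
apply: measurable_fun_infs => // i; apply: measurable_funD => //.
exact: measurable_norm2_dist.
Qed.

Lemma measurable_hull_proj (S : set (m.-tuple R)) : S !=set0 ->
  measurable_fun setT (hull_proj S).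
Proof.
move=> S0; apply/measurable_fun_tnthP => j; apply: lipschitz_measurable => y z /=.
rewrite -lerBlDl; apply: le_trans (hull_proj_nonexpansive _ _ _ S0).
apply: le_trans (normr_coord_le _ j); apply: le_trans (ler_norm _) _.
by rewrite fctE.
Qed.

End measurable_projection.

(** * Second moment of a normal variable from its exponential moments *)

Section accuracy.

(** The difference vanishes at 0 and its derivative [expR y + expR (- y) - 2] is the square of
    [expR (y / 2) - expR (- (y / 2))]. *)
Lemma expRB_ge {R : realType} (x : R) : 0 <= x -> 2 * x <= expR x - expR (- x).
Proof.
move=> x0; pose f (y : R) := expR y - expR (- y) - 2 * y.
have df (y : R) : is_derive y 1 f (expR y + expR (- y) - 2).
  have dN : is_derive y 1 (fun y => expR (- y)) (- expR (- y)).
    have := @is_derive1_comp R expR -%R y _ _ (is_derive_expR _) (is_deriveN (is_derive_id _ _)).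
    by rewrite mulrN1.
  have := is_deriveB (is_deriveB (is_derive_expR y) dN)
    (is_deriveZ (2 : R) (is_derive_id y (1 : R))).
  by rewrite opprK /GRing.scale/= mulr1.
suff : f 0 <= f x by rewrite /f oppr0 mulr0 subr0 subrr; lra.
apply: (@ger0_derive1_ndecry R f 0) => //.
- move=> y _; rewrite derive1E derive_val.
  have e1 : expR y = expR (y / 2) ^+ 2 by rewrite -expRM_natl mulrC divfK.
  have e2 : expR (- y) = expR (- (y / 2)) ^+ 2.
    by rewrite -expRM_natl mulrN mulrC divfK.
  have e3 : expR (y / 2) * expR (- (y / 2)) = 1 by rewrite -expRD subrr expR0.
  have := sqr_ge0 (expR (y / 2) - expR (- (y / 2))).
  by rewrite sqrrB e3 -e1 -e2; lra.
- by apply: derivable_within_continuous => y _; have [] := df y.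
Qed.

Lemma expR_cosh_ge {R : realType} (x : R) : x ^+ 2 + 2 <= expR x + expR (- x).
Proof.
wlog x0 : x / 0 <= x.
  move=> H; have [/H//|x0] := leP 0 x.
  have := H (- x); rewrite sqrrN opprK (addrC (expR (- x))); apply.
  by rewrite oppr_ge0 ltW.
have h := @expRB_ge R (x / 2) (divr_ge0 x0 (ler0n _ 2)).
have h2 : x ^+ 2 <= (expR (x / 2) - expR (- (x / 2))) ^+ 2.
  rewrite ler_sqr ?nnegrE//; first by move: h; rewrite mulrC divfK.
  by apply: le_trans h; rewrite mulr_ge0// divr_ge0.
move: h2.
have e1 : expR x = expR (x / 2) * expR (x / 2) by rewrite -expRD; congr expR; field.
have e2 : expR (- x) = expR (- (x / 2)) * expR (- (x / 2)).
  by rewrite -expRD; congr expR; field.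
have e3 : expR (x / 2) * expR (- (x / 2)) = 1 by rewrite -expRD subrr expR0.
rewrite e1 e2 sqrrB e3; lra.
Qed.

(** A comparison of slopes at 0: [expR r * (1 - r) <= 1] turns the hypothesis into
    [(r * x + 1) * (1 - r) <= 1] for [0 < r < 1], which fails for small [r] when [1 < x]. *)
Lemma expR_tangent_le1 {R : realType} (x : R) :
  (forall r, 0 < r -> r * x + 1 <= expR r) -> x <= 1.
Proof.
move=> bound; rewrite leNgt; apply/negP => x1.
have x0 : 0 < x by rewrite (lt_trans _ x1).
(* The midpoint of the range [0 < r < (x - 1) / x] on which [(r * x + 1) * (1 - r)] exceeds 1. *)
pose r := (x - 1) / (2 * x).
have r0 : 0 < r by rewrite divr_gt0 ?subr_gt0// mulr_gt0.
have rx : r * x = (x - 1) / 2 by rewrite /r; field; rewrite gt_eqF.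
have r1 : r < 1 by rewrite /r ltr_pdivrMr ?mulr_gt0//; lra.
have h4 : expR r * (1 - r) <= 1.
  have rN : expR r * expR (- r) = 1 by rewrite -expRD subrr expR0.
  by rewrite -[leRHS]rN ler_pM2l ?expR_gt0// expR_ge1Dx.
have : (r * x + 1) * (1 - r) <= 1.
  by apply: le_trans h4; rewrite ler_wpM2r ?bound// subr_ge0 ltW.
by nra.
Qed.

Context {R : realType} {dO : measure_display} {Omega : measurableType dO}
  (P : probability Omega R) {m : nat} (Z : 'I_m -> Omega -> R).
Hypothesis Ziid : iid_std_normal P Z.
Local Open Scope ereal_scope.

Lemma integral_exp_coord j (t : R) :
  \int[P]_w (expR (t * Z j w))%:E = (expR (t ^+ 2 / 2))%:E.
Proof.
have pick (F : 'I_m -> R -> R) : (forall i, F i 0 = 0)%R ->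
    (\sum_(i < m) F i (if i == j then t else 0) = F j t)%R.
  move=> F0; rewrite (bigD1 j)//= eqxx big1 ?addr0// => i /negbTE ->.
  exact: F0.
have := integral_exp_lin P Z Ziid (fun i => if i == j then t else 0%R).
rewrite (pick (fun _ s => s ^+ 2)%R); last by move=> _; rewrite expr0n.
move=> <-; apply: eq_integral => w _.
by rewrite (pick (fun i s => s * Z i w)%R)// => i; rewrite mul0r.
Qed.

(** Integrating [(t * Z) ^+ 2 + 2 <= expR (t * Z) + expR (- (t * Z))] gives
    [t ^+ 2 * I + 2 <= 2 * expR (t ^+ 2 / 2)]. The case [t = 1] shows that [I] is finite;
    [t ^+ 2 = 2 * r] with [r] tending to 0 gives [I <= 1]. *)
Lemma second_moment_coord j : \int[P]_w (Z j w ^+ 2)%:E <= 1.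
Proof.
have aux (r x : R) : (2 * r * x + 2 <= expR (2 * r / 2) + expR (2 * r / 2) ->
    r * x + 1 <= expR r)%R.
  have -> : (2 * r / 2 = r)%R by field.
  by lra.
have [mZ _] := Ziid.
have mZ2 : measurable_fun setT (fun w => (Z j w ^+ 2)%:E).
  by apply/measurable_EFinP; apply: measurable_funX; exact: mZ.
have mexp (t : R) : measurable_fun setT (fun w => (expR (t * Z j w))%:E).
  by apply/measurable_EFinP; apply: measurableT_comp => //; exact: measurable_funM.
set I := \int[P]_w _.
have I0 : 0 <= I by apply: integral_ge0 => w _; rewrite lee_fin sqr_ge0.
have bound (t : R) : (t ^+ 2)%:E * I + 2%:E <= (expR (t ^+ 2 / 2) + expR (t ^+ 2 / 2))%:E.
  rewrite /I -ge0_integralZl//; last 2 first.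
  - by move=> w _; rewrite lee_fin sqr_ge0.
  - by rewrite lee_fin sqr_ge0.
  have -> : 2%:E = \int[P]_w (cst 2%:E w) :> \bar R.
    by rewrite integral_cst//= probability_setT mule1.
  rewrite -ge0_integralD//; last 3 first.
  - by move=> w _; rewrite mule_ge0// lee_fin sqr_ge0.
  - exact: measurable_funeM.
  - by move=> w _; rewrite lee_fin.
  rewrite [leRHS]EFinD -{1}(integral_exp_coord j t) -sqrrN -(integral_exp_coord j (- t)).
  rewrite -ge0_integralD//; try by move=> w _; rewrite lee_fin expR_ge0.
  apply: ge0_le_integral => //.
  - by move=> w _; rewrite adde_ge0 ?mule_ge0 ?lee_fin ?sqr_ge0.
  - by apply: emeasurable_funD => //; exact: measurable_funeM.
  - exact: emeasurable_funD.
  - move=> w _; rewrite -EFinM -!EFinD lee_fin -exprMn mulNr.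
    by rewrite sqrrN; exact: expR_cosh_ge.
have Ifin : I \is a fin_num.
  rewrite ge0_fin_numE// ltey; apply/eqP => Iy.
  by have := bound 1%R; rewrite expr1n mul1e Iy addye.
rewrite -(fineK Ifin) lee_fin; apply: expR_tangent_le1 => r r0.
have := bound (Num.sqrt (2 * r)).
rewrite sqr_sqrtr ?mulr_ge0 ?(ltW r0)// -(fineK Ifin) -EFinM -EFinD lee_fin.
exact: aux.
Qed.
End accuracy.

(** * Error of the projected Gaussian vector *)

Section projected_gaussian.
Local Notation conv := Defs.conv.
Context {R : realType} {dO : measure_display} {Omega : measurableType dO}
  (P : probability Omega R) {m : nat} (Z : 'I_m -> Omega -> R).
Hypothesis Ziid : iid_std_normal P Z.
Variables (S : set (m.-tuple R)) (q : m.-tuple R) (sigma : R).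
Hypotheses (S0 : S !=set0) (Cq : conv S q) (sigma0 : 0 < sigma).

Let M (w : Omega) := hull_proj S (vadd q [tuple sigma * Z j w | j < m]).

Let zvec (w : Omega) : 'I_m -> R := fun j => Z j w.

Let tnth_noise w : tnth (vadd q [tuple sigma * Z j w | j < m]) = tnth q + sigma *: zvec w.
Proof. by apply/funext => j; rewrite !tnth_mktuple. Qed.

Lemma measurable_projected_gaussian : measurable_fun setT M.
Proof.
apply: (measurableT_comp (measurable_hull_proj S S0)).
apply/measurable_fun_tnthP => j.
rewrite [X in measurable_fun _ X](_ : _ = fun w => tnth q j + sigma * Z j w).
  apply: measurable_funD => //; apply: measurable_funM => //.
  by have [mZ _] := Ziid; exact: mZ.
by apply/funext => w /=; rewrite !tnth_mktuple.
Qed.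

Let D w := nsq (tnth (M w) - tnth q).

Let D0 w : 0 <= D w. Proof. exact: nsq_ge0. Qed.

Let mD : measurable_fun setT D.
Proof.
rewrite (_ : D = fun w => norm2 (tnth (M w) - tnth q) ^+ 2).
  apply: measurable_funX.
  exact: (measurableT_comp (measurable_norm2_dist (tnth q)) measurable_projected_gaussian).
by apply/funext => w; rewrite sqr_norm2.
Qed.

Let DE : ('E_P[fun w => (m%:R^-1 * vnorm (vsub (M w) q) ^+ 2)%R] =
  (m%:R^-1)%:E * \int[P]_w (D w)%:E)%E.
Proof.
rewrite unlock -ge0_integralZl//; last 2 first.
- exact/measurable_EFinP.
- by move=> w _; rewrite lee_fin.
by apply: eq_integral => w _; rewrite vnorm_vsub sqr_norm2 EFinM.
Qed.

Let D_le w : D w <= sigma * dot (zvec w) (tnth (M w) - tnth q).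
Proof.
have := hull_proj_dist S (vadd q [tuple sigma * Z j w | j < m]) q S0 (sub_vclosure _ _ Cq).
by rewrite tnth_noise addrAC subrr add0r dotZl.
Qed.

Lemma projected_gaussian_error_noise :
  ('E_P[fun w => (m%:R^-1 * vnorm (vsub (M w) q) ^+ 2)%R] <= (sigma ^+ 2)%:E)%E.
Proof.
have [mZ _] := Ziid.
rewrite DE.
(* With [x] the inner product of noise and error, [D <= sigma * x] is combined with [0 <= D - 2 *
   sigma * x + sigma ^+ 2 * nsq (zvec w)], so no norm has to be divided out. *)
have Dle w : D w <= sigma ^+ 2 * nsq (zvec w).
  have := D_le w; have := nsq_ge0 ((tnth (M w) - tnth q) + (- sigma) *: zvec w).
  rewrite nsqDZ -/(D w) (dotC (zvec w)).
  by move: (dot _ _) (nsq _) => x y; lra.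
have mz j : measurable_fun setT (fun w => (Z j w ^+ 2)%:E).
  by apply/measurable_EFinP; apply: measurable_funX; exact: mZ.
apply: (@le_trans _ _ ((m%:R^-1)%:E * (sigma ^+ 2 * m%:R)%:E)%E).
  apply: lee_wpmul2l; first by rewrite lee_fin invr_ge0.
  apply: (@le_trans _ _ (\int[P]_w ((sigma ^+ 2)%:E * \sum_(j < m) (Z j w ^+ 2)%:E))%E).
    apply: ge0_le_integral => //.
    - by move=> w _; rewrite lee_fin.
    - exact/measurable_EFinP.
    - by apply: measurable_funeM; exact: emeasurable_sum.
    - move=> w _; rewrite sumEFin -EFinM lee_fin; apply: le_trans (Dle w) _.
      by rewrite ler_wpM2l ?sqr_ge0.
  rewrite ge0_integralZl//; last 3 first.
  - exact: emeasurable_sum.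
  - by move=> w _; apply: sume_ge0 => j _; rewrite lee_fin sqr_ge0.
  - by rewrite lee_fin sqr_ge0.
  rewrite [leRHS]EFinM; apply: lee_wpmul2l; first by rewrite lee_fin sqr_ge0.
  rewrite ge0_integral_sum//; last by move=> j w _; rewrite lee_fin sqr_ge0.
  apply: (@le_trans _ _ (\sum_(j < m) 1)%E).
    by apply: lee_sum => j _; exact: second_moment_coord.
  by rewrite sumEFin sumr_const card_ord.
rewrite -EFinM lee_fin mulrCA.
have [->|m0] := eqVneq (m%:R : R) 0; first by rewrite mulr0 mulr0 sqr_ge0.
by rewrite mulVf// mulr1.
Qed.

(** The projection lies in the closed hull, where a linear functional obeys every upper bound that
    it has on [S]. *)
Lemma projected_gaussian_dot_le w (B : R) :
  (forall s, S s -> dot (zvec w) (tnth s - tnth q) <= B) -> D w <= sigma * B.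
Proof.
move=> HB; apply: le_trans (D_le w) _; rewrite ler_pM2l//.
have [CM _] := hull_projP S (vadd q [tuple sigma * Z j w | j < m]) S0.
rewrite dotDr dotNr lerBlDr.
apply: dot_vclosure_conv_le CM => s Ss.
by have := HB s Ss; rewrite dotDr dotNr lerBlDr.
Qed.

(** Serves the case of zero sensitivity, where the maximal inequality below would divide by
    [Delta]. *)
Lemma projected_gaussian_error_const : (forall s, S s -> s = q) ->
  ('E_P[fun w => (m%:R^-1 * vnorm (vsub (M w) q) ^+ 2)%R] = 0)%E.
Proof.
move=> Sq; rewrite DE (_ : (fun w => (D w)%:E) = cst 0%E) ?integral0 ?mule0//.
apply/funext => w; congr _%:E; apply/eqP; rewrite eq_le D0 andbT.
rewrite -(mulr0 sigma); apply: projected_gaussian_dot_le => s /Sq ->.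
by rewrite subrr /dot big1// => j _; rewrite mulr0.
Qed.

(* The maximum of the Gaussian variables [X_k] is bounded through
   [t * max X <= a - 1 + sum_k expR (t * X_k - a)], with [t] and [a] optimized. *)
Lemma projected_gaussian_error_max (N : nat) (p : nat -> m.-tuple R) (Delta : R) :
  (1 < N)%N -> 0 < Delta ->
  (forall s, S s -> exists2 k, (k < N)%N & s = p k) ->
  (forall k, (k < N)%N -> norm2 (tnth (p k) - tnth q) <= Delta) ->
  ('E_P[fun w => (m%:R^-1 * vnorm (vsub (M w) q) ^+ 2)%R] <=
   (sigma * Num.sqrt (2 * ln (N%:R : R)) / m%:R * Delta)%:E)%E.
Proof.
move=> N1 Delta0 Sp pD.
have lnN : 0 < ln (N%:R : R) by rewrite ln_gt0// ltr1n.
set r := Num.sqrt _.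
have r0 : 0 < r by rewrite sqrtr_gt0 mulr_gt0.
have rr : r ^+ 2 = 2 * ln (N%:R : R) by rewrite sqr_sqrtr// mulr_ge0// ltW.
(* Chosen so that each [e k] has mean at most [expR (r ^+ 2 / 2 - a) = N^-1]. The [N] terms then sum
   to at most 1, which cancels the [- 1] and leaves [a / t = r * Delta]. *)
pose t := r / Delta; pose a := r ^+ 2.
have t0 : 0 < t by rewrite divr_gt0.
pose X k w := dot (zvec w) (tnth (p k) - tnth q).
pose e k w := expR (t * X k w - a).
have e0 k w : 0 <= e k w by exact: expR_ge0.
have me k : measurable_fun setT (e k).
  apply: measurableT_comp => //; apply: measurable_funB => //; apply: measurable_funM => //.
  apply: measurable_sum => j; apply: measurable_funM => //.
  by have [mZ _] := Ziid; exact: mZ.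
have Ee k : (k < N)%N -> (\int[P]_w (e k w)%:E <= (N%:R^-1)%:E)%E.
  move=> kN; pose v := tnth (p k) - tnth q.
  have eE w : e k w = expR (- a) * expR (\sum_(j < m) (t * v j) * Z j w).
    rewrite -expRD /e addrC; congr (expR (_ + _)).
    by rewrite /X /dot mulr_sumr; apply: eq_bigr => j _; rewrite -mulrA; congr (_ * _); exact: mulrC.
  under eq_integral do rewrite eE EFinM.
  rewrite ge0_integralZl//; last first.
    apply/measurable_EFinP; apply: measurableT_comp => //.
    apply: measurable_sum => j; apply: measurable_funM => //.
    by have [mZ _] := Ziid; exact: mZ.
  rewrite (integral_exp_lin P Z Ziid) -EFinM lee_fin -expRD.
  rewrite -[leRHS]lnK ?posrE ?invr_gt0 ?ltr0n ?(ltn_trans _ N1)// ler_expR.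
  rewrite lnV ?posrE ?ltr0n ?(ltn_trans _ N1)//.
  have -> : \sum_(j < m) (t * v j) ^+ 2 = t ^+ 2 * nsq v.
    by rewrite mulr_sumr; apply: eq_bigr => j _; rewrite exprMn (expr2 (v j)).
  have vD : nsq v <= Delta ^+ 2.
    by rewrite -sqr_norm2 ler_sqr ?nnegrE ?norm2_ge0 ?(ltW Delta0)// pD.
  have : t ^+ 2 * nsq v <= r ^+ 2.
    apply: (@le_trans _ _ (t ^+ 2 * Delta ^+ 2)); first by rewrite ler_wpM2l ?sqr_ge0.
    by rewrite -exprMn /t divfK// gt_eqF.
  by rewrite /a rr; lra.
have key w : t * D w <= sigma * (a - 1) + sigma * \sum_(k < N) e k w.
  rewrite -mulrDr -ler_pdivlMl// mulrCA.
  apply: projected_gaussian_dot_le => s Ss; have [k kN ->] := Sp s Ss.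
  rewrite ler_pdivlMl//.
  have ek : e k w <= \sum_(k < N) e k w.
    by rewrite (bigD1 (Ordinal kN))//= lerDl sumr_ge0.
  have := expR_ge1Dx (t * X k w - a); rewrite -/(e k w) /X.
  by move: ek; lra.
(* [sigma] is added on both sides so that the integrands are nonnegative whatever the sign of
   [a - 1]. *)
have int : (t%:E * \int[P]_w (D w)%:E <= (sigma * a)%:E)%E.
  have sigma_ge0 : 0 <= sigma by exact: ltW.
  have meS : measurable_fun setT (fun w => (\sum_(k < N) (e k w)%:E)%E).
    by apply: emeasurable_sum => k; exact/measurable_EFinP.
  have IS : (\int[P]_w (\sum_(k < N) (e k w)%:E) <= 1)%E.
    rewrite ge0_integral_sum//.
    - apply: (@le_trans _ _ (\sum_(k < N) (N%:R^-1)%:E)%E).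
        by apply: lee_sum => k _; exact: Ee.
      by rewrite sumEFin sumr_const card_ord -[X in (X%:E <= _)%E]mulr_natl divff// pnatr_eq0 -lt0n (ltn_trans _ N1).
    - by move=> k; exact/measurable_EFinP.
    - by move=> k w _; rewrite lee_fin.
  have ITD : (\int[P]_w (t%:E * (D w)%:E + sigma%:E) <=
      \int[P]_w ((sigma * a)%:E + sigma%:E * \sum_(k < N) (e k w)%:E))%E.
    apply: ge0_le_integral => //.
    - by move=> w _; rewrite adde_ge0 ?mule_ge0 ?lee_fin// ltW.
    - apply: emeasurable_funD => //; apply: measurable_funeM.
      exact/measurable_EFinP.
    - by apply: emeasurable_funD => //; exact: measurable_funeM.
    - move=> w _; rewrite sumEFin -!EFinM -!EFinD lee_fin.
      by have := key w; rewrite mulrBr mulr1; lra.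
  rewrite -(@leeD2rE _ sigma%:E)//.
  apply: (@le_trans _ _ (\int[P]_w (t%:E * (D w)%:E + sigma%:E))%E).
    rewrite ge0_integralD//; last 2 first.
    - by move=> w _; rewrite mule_ge0 ?lee_fin// ltW.
    - by apply: measurable_funeM; exact/measurable_EFinP.
    rewrite ge0_integralZl//; last 3 first.
    - exact/measurable_EFinP.
    - by move=> w _; rewrite lee_fin.
    - by rewrite lee_fin ltW.
    by rewrite integral_cst//= probability_setT mule1.
  apply: le_trans ITD _; rewrite ge0_integralD//; last 3 first.
  - by move=> w _; rewrite lee_fin mulr_ge0// sqr_ge0.
  - by move=> w _; rewrite mule_ge0 ?lee_fin// sumEFin lee_fin sumr_ge0.
  - exact: measurable_funeM.
  rewrite integral_cst//= probability_setT mule1 ge0_integralZl//; last first.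
    by move=> w _; rewrite sumEFin lee_fin sumr_ge0.
  by rewrite leeD2l// -[leRHS]mule1 lee_wpmul2l.
rewrite DE; apply: (@le_trans _ _ ((m%:R^-1)%:E * (t^-1%:E * (sigma * a)%:E))%E).
  apply: lee_wpmul2l; first by rewrite lee_fin invr_ge0.
  by rewrite lee_pdivlMl.
rewrite -!EFinM lee_fin le_eqVlt; apply/orP; left; apply/eqP.
rewrite /t /a invf_div expr2.
have -> : Delta / r * (sigma * (r * r)) = Delta * sigma * r.
  by field; rewrite gt_eqF.
by ring.
Qed.

End projected_gaussian.

(** * The averaged query and the privacy bound for one changed entry *)

Section mechanism.
Local Notation conv := Defs.conv.
Context {R : realType} {m n : nat} {XT : Type} (Q : XT -> m.-tuple R).
Hypothesis n0 : (0 < n)%N.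
Implicit Types x : 'I_n -> XT.

Let nR : 0 < n%:R :> R. Proof. by rewrite ltr0n. Qed.

Lemma conv_qavg x : conv (range Q) (qavg Q x).
Proof.
exists n, (fun=> n%:R^-1), (Q \o x); split.
- by move=> i; rewrite invr_ge0.
- by rewrite sumr_const card_ord -[LHS]mulr_natl divff// gt_eqF.
- by move=> i; exists (x i).
- by apply: eq_from_tnth => j; rewrite !tnth_mktuple mulr_sumr.
Qed.

Lemma qavg_differ_only_at i x x' : differ_only_at i x x' ->
  tnth (qavg Q x) - tnth (qavg Q x') =
  n%:R^-1 *: (tnth (Q (x i)) - tnth (Q (x' i))).
Proof.
move=> xx'; apply/funext => j; rewrite !fctE !tnth_mktuple -mulrBr; congr (_ * _).
rewrite (bigD1 i)//= [X in _ - X](bigD1 i)//= opprD addrACA.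
rewrite -[RHS]addr0; congr (_ + _); apply/eqP; rewrite subr_eq0; apply/eqP.
by apply: eq_bigr => k ki; rewrite xx'.
Qed.

(** The left vector is the average of the differences [Q u - Q (x i)], so centring at the average
    costs no factor over [Delta]. *)
Lemma norm2_sub_qavg (Delta : R) (u : XT) x :
  (forall v, norm2 (tnth (Q u) - tnth (Q v)) <= Delta) ->
  norm2 (tnth (Q u) - tnth (qavg Q x)) <= Delta.
Proof.
move=> uD.
have -> : tnth (Q u) - tnth (qavg Q x) =
    n%:R^-1 *: \sum_(i < n) (tnth (Q u) - tnth (Q (x i))).
  apply/funext => j; rewrite !fctE tnth_mktuple /GRing.scale/= fct_sumE.
  under [in RHS]eq_bigr do rewrite fctE.
  rewrite sumrB sumr_const card_ord mulrBr -[X in _ = _ * X - _]mulr_natl mulKf//.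
  by rewrite gt_eqF.
rewrite norm2Z ger0_norm ?invr_ge0// ler_pdivrMl//.
apply: le_trans (norm2_sum _ _ _) _.
apply: (@le_trans _ _ (\sum_(i < n) Delta)); first exact: ler_sum.
by rewrite sumr_const card_ord mulr_natl.
Qed.

Context {dO : measure_display} {Omega : measurableType dO}
  (P : probability Omega R) (Z : 'I_m -> Omega -> R) (sigma : R).
Hypotheses (Ziid : iid_std_normal P Z) (sigma0 : 0 < sigma).

(* Shifting the mean of the Gaussian vector by [qavg Q x - qavg Q x'] turns
   [M x'] into [M x], so that both laws are images, under one and the same
   map, of a standard Gaussian vector and of its translate. *)
Lemma renyi_star_gauss_mech i x x' : differ_only_at i x x' ->
  (renyi_star (pushforward P (gauss_mech Q sigma Z x))
     (pushforward P (gauss_mech Q sigma Z x')) <=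
   (2^-1 * (sigma * n%:R)^-2 * vnorm (vsub (Q (x i)) (Q (x' i))) ^+ 2)%:E)%E.
Proof.
move=> xx'.
have S0 : range Q !=set0 by exists (Q (x i)), (x i).
pose H (t : m.-tuple R) := hull_proj (range Q)
  (vadd (qavg Q x') [tuple sigma * tnth t j | j < m]).
pose c j := sigma^-1 * (tnth (qavg Q x) j - tnth (qavg Q x') j).
have -> : gauss_mech Q sigma Z x = H \o zshift Z c.
  apply/funext => w; rewrite /gauss_mech /H /=; congr hull_proj.
  apply: eq_from_tnth => j; rewrite /c !tnth_mktuple.
  by field; rewrite !gt_eqF.
have -> : gauss_mech Q sigma Z x' = H \o ztup Z.
  apply/funext => w; rewrite /gauss_mech /H /=; congr hull_proj.
  by apply: eq_from_tnth => j; rewrite !tnth_mktuple.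
have mH : measurable_fun setT H.
  apply: (measurableT_comp (measurable_hull_proj _ S0)).
  apply/measurable_fun_tnthP => j.
  rewrite [X in measurable_fun _ X](_ : _ = fun t => tnth (qavg Q x') j + sigma * tnth t j).
    apply: measurable_funD => //; apply: measurable_funM => //.
    exact: measurable_tnth.
  by apply/funext => t /=; rewrite !tnth_mktuple.
apply: le_trans (renyi_star_gauss_shift P Z Ziid H c mH) _.
rewrite lee_fin le_eqVlt; apply/orP; left; apply/eqP.
have -> : \sum_(j < m) c j ^+ 2 =
    nsq (sigma^-1 *: (tnth (qavg Q x) - tnth (qavg Q x'))).
  by apply: eq_bigr => j _; rewrite expr2.
rewrite (qavg_differ_only_at _ _ _ xx') -sqr_norm2 !norm2Z vnorm_vsub.
rewrite !ger0_norm ?invr_ge0 ?ltW//.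
by field; rewrite !gt_eqF.
Qed.

End mechanism.

(** * Sensitivities and the Hamming distance *)

Section sensitivity.
Local Open Scope ereal_scope.
Context {R : realType} {m : nat}.

Lemma sens_ge {XT : Type} (Q : XT -> m.-tuple R) (adm : XT -> XT -> Prop) u v :
  adm u v -> (vnorm (vsub (Q u) (Q v)))%:E <= sens Q adm.
Proof. by move=> uv; apply: ereal_sup_ubound; exists u, v. Qed.

Lemma vnorm_vsub_self (p : m.-tuple R) : vnorm (vsub p p) = 0%R.
Proof. by rewrite vnorm_vsub subrr /norm2 /nsq /dot big1 ?sqrtr0// => j _; rewrite mul0r. Qed.

Lemma sens_ge0 {XT : Type} (Q : XT -> m.-tuple R) (adm : XT -> XT -> Prop) u :
  adm u u -> 0 <= sens Q adm.
Proof. by move=> uu; have := sens_ge Q adm u u uu; rewrite vnorm_vsub_self. Qed.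

Lemma ham0E (d : nat) (T : 'I_d -> Type) (u v : forall j, T j) :
  ham0 u v = #|[pred j | `[< u j <> v j >]]|.
Proof. by apply: eq_card => j; apply/asboolP/idP. Qed.

Lemma ham0_refl (d : nat) (T : 'I_d -> Type) (u : forall j, T j) : ham0 u u = 0%N.
Proof. by rewrite ham0E; apply: eq_card0 => j; apply/asboolP; case. Qed.

(** Induction on the Hamming distance. For an infinite sensitivity the base case reads
    [0 * +oo = 0], in accordance with [u = v]. *)
Lemma vnorm_ham0_le (d : nat) (T : 'I_d -> Type)
    (Q : (forall j, T j) -> m.-tuple R) (u v : forall j, T j) :
  (vnorm (vsub (Q u) (Q v)))%:E <=
  (ham0 u v)%:R%:E * sens Q (fun u v => (ham0 u v <= 1)%N).
Proof.
set D0 := sens _ _.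
have D00 : 0 <= D0 by apply: (sens_ge0 Q _ u); rewrite ham0_refl.
move: {2}(ham0 u v) (erefl (ham0 u v)) => k; elim: k u => [|k IH] u.
  move=> uv; have /card0_eq E := etrans (esym (ham0E _ _ u v)) uv.
  have -> : u = v.
    apply: functional_extensionality_dep => j; apply: contrapT => uvj.
    by have := E j; rewrite inE asboolT.
  by rewrite ham0_refl mul0e vnorm_vsub_self.
move=> uv; have [j] : exists j, j \in [pred j | `[< u j <> v j >]].
  by apply/card_gt0P; rewrite -ham0E uv.
rewrite uv => uvj.
(* One coordinate away from [u] and [k] away from [v]. *)
pose w i := if i == j then v i else u i.
have uw : (ham0 u w <= 1)%N.
  rewrite ham0E -(card1 j); apply: subset_leq_card; apply/fintype.subsetP => i.
  by rewrite !inE /w; case: eqP => // _ [].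
have wv : ham0 w v = k.
  move: uv; rewrite !ham0E (cardD1 j) uvj add1n => -[<-].
  apply: eq_card => i; rewrite !inE /w; case: eqP => [->|] //=.
  by apply/asboolP; case.
have -> : (k.+1%:R = 1 + k%:R :> R)%R by rewrite -natr1 addrC.
rewrite EFinD ge0_muleDl ?lee_fin// mul1e.
apply: (@le_trans _ _ ((vnorm (vsub (Q u) (Q w)))%:E + (vnorm (vsub (Q w) (Q v)))%:E)).
  rewrite -EFinD lee_fin !vnorm_vsub.
  have -> : (tnth (Q u) - tnth (Q v) =
      (tnth (Q u) - tnth (Q w)) + (tnth (Q w) - tnth (Q v)))%R.
    by apply/funext => i; rewrite !fctE; ring.
  exact: norm2D.
apply: leeD; first exact: (sens_ge Q).
by have := IH w wv; rewrite wv.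
Qed.

End sensitivity.

(** * Finite domains and the final assembly *)

(** [p] is a left inverse of an injection into [I_N], with value [x0] off its image; repetitions are
    harmless when bounding a maximum by a sum. *)
Lemma card_eq_II_enum (T : Type) (x0 : T) (N : nat) :
  ([set: T] #= `I_N)%card -> exists p : nat -> T, forall u, exists2 k, (k < N)%N & u = p k.
Proof.
rewrite card_eq_le => /andP[/pcard_leP/unsquash f _].
pose p k := if pselect (exists u, f u = k) is left h then projT1 (cid h) else x0.
exists p => u; exists (f u); first exact: (@funS _ _ _ _ f u I).
rewrite /p; case: pselect => [h|[]]; last by exists u.
by apply/esym/(@inj _ _ _ f); rewrite ?in_setT//; exact: projT2 (cid h).
Qed.

Lemma gauss_mech_error_card {R : realType} {m n : nat} {XT : Type}
    (Q : XT -> m.-tuple R) {dO : measure_display} {Omega : measurableType dO}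
    (P : probability Omega R) (Z : 'I_m -> Omega -> R) (sigma : R) (x : 'I_n -> XT) :
  (0 < n)%N -> 0 < sigma -> iid_std_normal P Z ->
  ('E_P[fun w => (m%:R^-1 * vnorm (vsub (gauss_mech Q sigma Z x w) (qavg Q x)) ^+ 2)%R]
     <= card_bound XT sigma (sens Q (fun _ _ => True)) m)%E.
Proof.
move=> n0 sigma0 Ziid; rewrite /card_bound; case: pselect => [h|_]; last exact: leey.
case: (cid h) => N cardN /=; have x0 := x (Ordinal n0).
have S0 : range Q !=set0 by exists (Q x0), x0.
have [p pT] := card_eq_II_enum _ x0 _ cardN.
set D := sens _ _.
have D0 : (0 <= D)%E by exact: (sens_ge0 Q _ x0).
have Dle u v : ((norm2 (tnth (Q u) - tnth (Q v)))%:E <= D)%E.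
  by rewrite -vnorm_vsub; exact: (sens_ge Q).
(* On a finite domain the supremum is at most the sum of all pairwise distances. *)
have Dfin : D \is a fin_num.
  rewrite ge0_fin_numE//.
  pose B := \sum_(k < N) \sum_(l < N) vnorm (vsub (Q (p k)) (Q (p l))).
  apply: (@le_lt_trans _ _ B%:E); last exact: ltry.
  apply: ge_ereal_sup => _ [u [v [_ ->]]].
  have [k kN ->] := pT u; have [l lN ->] := pT v; rewrite lee_fin.
  rewrite /B (bigD1 (Ordinal kN))//= (bigD1 (Ordinal lN))//= -addrA lerDl.
  rewrite addr_ge0// sumr_ge0// => *; first exact: sqrtr_ge0.
  by apply: sumr_ge0 => *; exact: sqrtr_ge0.
rewrite -(fineK Dfin).
have {}Dle u v : norm2 (tnth (Q u) - tnth (Q v)) <= fine D.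
  by rewrite -lee_fin fineK.
have Dq u : norm2 (tnth (Q u) - tnth (qavg Q x)) <= fine D.
  by apply: norm2_sub_qavg => // v.
have [Dz|Dnz] := eqVneq (fine D) 0.
  rewrite (projected_gaussian_error_const P Z Ziid _ _ _ S0 (conv_qavg Q n0 x) sigma0).
    by rewrite Dz mule0.
  move=> _ [u _ <-]; apply: eq_from_tnth => j; apply/eqP; rewrite -subr_eq0 -normr_le0.
  have := normr_coord_le (tnth (Q u) - tnth (qavg Q x)) j.
  by rewrite fctE => /le_trans; apply; rewrite -Dz; exact: Dq.
have Dpos : 0 < fine D by rewrite lt_neqAle eq_sym Dnz fine_ge0.
rewrite -EFinM.
apply: (projected_gaussian_error_max P Z Ziid _ _ _ S0 (conv_qavg Q n0 x) sigma0 N (Q \o p)) => //.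
(* A domain with at most one point would have zero sensitivity; two points are needed for [ln N] to
   be positive. *)
- rewrite ltnNge; apply/negP => N1; move/eqP: Dnz; apply.
  apply/eqP; rewrite eq_le fine_ge0// andbT -lee_fin fineK//.
  apply: ge_ereal_sup => _ [u [v [_ ->]]].
  have [k kN ->] := pT u; have [l lN ->] := pT v.
  move: (leq_trans kN N1) (leq_trans lN N1); rewrite !ltnS !leqn0 => /eqP -> /eqP ->.
  by rewrite vnorm_vsub_self.
- by move=> _ [u _ <-]; have [k kN ->] := pT u; exists k.
- by move=> k _; exact: Dq.
Qed.

Theorem theorem4p1
  (R : realType) (d : nat) (T : 'I_d -> Type) (m n : nat)
  (Q : (forall j : 'I_d, T j) -> m.-tuple R) (sigma : R)
  (dO : measure_display) (Omega : measurableType dO) (P : probability Omega R)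
  (Z : 'I_m -> Omega -> R) :
  (0 < n)%N -> 0 < sigma -> iid_std_normal P Z ->
  let Delta := sens Q (fun _ _ => True) in
  let Delta0 := sens Q (fun u v => (ham0 u v <= 1)%N) in
  let M := @gauss_mech R m n _ _ Omega Q sigma Z in
  (* output distribution of M(x) *)
  let law := fun x : 'I_n -> (forall j : 'I_d, T j) => pushforward P (M x) in
  (* 1/2 eps^2 - zCDP with eps = Delta / (sigma n) *)
  (forall (i : 'I_n) (x x' : 'I_n -> forall j : 'I_d, T j),
     differ_only_at i x x' ->
     (renyi_star (law x) (law x') <=
        (2^-1 * (sigma * n%:R)^-2)%:E * (Delta * Delta))%E) /\
  (* eps0 - nabla_0 CDP with eps0 = Delta0 / (sigma n) *)
  (forall (i : 'I_n) (x x' : 'I_n -> forall j : 'I_d, T j),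
     differ_only_at i x x' ->
     (renyi_star (law x) (law x') <=
        (2^-1 * (sigma * n%:R)^-2 * ((ham0 (x i) (x' i))%:R) ^+ 2)%:E
          * (Delta0 * Delta0))%E) /\
  (* accuracy *)
  (forall x : 'I_n -> forall j : 'I_d, T j,
     ('E_P[fun w => (m%:R^-1 * vnorm (vsub (M x w) (qavg Q x)) ^+ 2)%R] <=
        mine (sigma ^+ 2)%:E (card_bound (forall j : 'I_d, T j) sigma Delta m))%E).
Proof.
move=> n0 sigma0 Ziid Delta Delta0 M law.
have coef0 : 0 <= 2^-1 * (sigma * n%:R)^-2.
  by rewrite mulr_ge0// invr_ge0 sqr_ge0.
have renyi_le i x x' : differ_only_at i x x' -> (renyi_star (law x) (law x') <=
    (2^-1 * (sigma * n%:R)^-2)%:E *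
    ((vnorm (vsub (Q (x i)) (Q (x' i))))%:E * (vnorm (vsub (Q (x i)) (Q (x' i))))%:E))%E.
  move=> xx'; rewrite -!EFinM -expr2.
  exact: (renyi_star_gauss_mech Q n0 P Z sigma Ziid sigma0).
have vnorm0 p q : (0 <= (vnorm (@vsub R m p q))%:E)%E by rewrite lee_fin sqrtr_ge0.
split; [move=> i x x' xx'|split; [move=> i x x' xx'|move=> x]].
- apply: le_trans (renyi_le _ _ _ xx') _; apply: lee_wpmul2l; first by rewrite lee_fin.
  by apply: lee_pmul => //; exact: (sens_ge Q).
- apply: le_trans (renyi_le _ _ _ xx') _.
  (* The squares are regrouped as the product of [ham0 * Delta0] with itself, so that
     [vnorm_ham0_le] applies to each factor. *)
  rewrite expr2 [X in (_ <= X * _)%E]EFinM -muleA; apply: lee_wpmul2l; first by rewrite lee_fin.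
  rewrite EFinM muleACA.
  by apply: lee_pmul => //; exact: vnorm_ham0_le.
- rewrite le_min; apply/andP; split; last exact: gauss_mech_error_card.
  apply: projected_gaussian_error_noise => //; last exact: conv_qavg.
  by exists (Q (x (Ordinal n0))), (x (Ordinal n0)).
Qed.
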